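(* For every convex polyhedron $P\subset\mathbb R^3$, \[ \delta(P)=V(P)-1-A(P)+B(P)\ge 0, \] equivalently $A(P)-B(P)\le V(P)-1$. More precisely, $\delta(P)=\beta_2(X(P);\mathbb Q)$, where $X(P)$ is the antipodal square complex of $P$ and $\beta_2(X(P);\mathbb Q)=\dim_{\mathbb Q}H_2(X(P);\mathbb Q)$.
   Context: A convex polyhedron $P\subset\mathbb R^3$ means a compact full-dimensional convex polytope. Two points of $P$ are antipodal if there are two parallel supporting planes of $P$, one through each point, that contain $P$ between them. $V(P)$ is the number of vertices of $P$; $A(P)$ is the number of unordered pairs of distinct vertices of $P$ that are antipodal; $B(P)$ is the number of unordered pairs of distinct edges of $P$ whose midpoints are antipodal. The antipodal defect is $\delta(P)=V(P)-1-A(P)+B(P)$. The antipodal graph $G_A(P)$ has as vertices the vertices of $P$, with an edge $vw$ whenever $v,w$ are distinct antipodal vertices. The antipodal square complex $X(P)$ is the two-dimensional finite CW complex obtained from $G_A(P)$ by attaching one square 2-cell for every unordered pair $\{e,f\}$ of distinct edges of $P$ whose midpoints are antipodal: if $e=vv'$ and $f=ww'$, the square is attached along the four-cycle $v-w-v'-w'-v$ (such $e,f$ are disjoint, so the four vertices are distinct, and the four vertex pairs used are antipodal). Different edge pairs giving the same boundary cycle still give distinct 2-cells. *)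

(* Defs.v *)
From mathcomp Require Export all_boot all_order all_algebra finmap.
From mathcomp Require Export all_classical all_reals all_analysis.
From mathcomp Require Import ring lra.

Set Implicit Arguments.
Unset Strict Implicit.
Unset Printing Implicit Defensive.

Import Order.TTheory GRing.Theory Num.Theory.
Export numFieldNormedType.Exports.

Local Open Scope fset_scope.
Local Open Scope classical_set_scope.
Local Open Scope ring_scope.

Section Polyhedra.
Variable R : realType.
Local Notation pt := 'rV[R]_3.
Implicit Types (P F : set pt) (u v w x y z : pt) (e f : {fset pt}).

Definition dot u x : R := \sum_(i < 3) u 0 i * x 0 i.

Definition conv_hull n (p : 'I_n -> pt) : set pt :=
  [set x | exists a : 'I_n -> R, [/\ forall i, 0 <= a i,
     \sum_(i < n) a i = 1 & x = \sum_(i < n) a i *: p i]].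

Definition convex_polyhedron P : Prop :=
  (exists n (p : 'I_n -> pt), P = conv_hull p) /\ interior P !=set0.

Definition segment v w : set pt :=
  [set x | exists2 t : R, 0 <= t <= 1 & x = (1 - t) *: v + t *: w].

(* Exposed faces; u = 0 gives P itself, which is neither a point nor a
   segment when P is full-dimensional. *)
Definition is_face P F : Prop :=
  F !=set0 /\
  exists u, F = [set x | P x /\ forall y, P y -> dot u y <= dot u x].

Definition is_vertex P v : Prop := is_face P [set v].

(* An edge is encoded by the set of its two endpoints. *)
Definition is_edge P e : Prop :=
  exists v w, [/\ v != w, e = [fset v; w] & is_face P (segment v w)].

Definition midpoint e : pt := 2^-1 *: \sum_(v <- e) v.

(* The supporting planes are {z | dot u z = dot u x} and
   {z | dot u z = dot u y}. *)
Definition antipodal P x y : Prop :=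
  [/\ P x, P y & exists2 u, u != 0 &
    forall z, P z -> dot u y <= dot u z <= dot u x].

Definition is_antipodal_vertex_pair P (p : {fset pt}) : Prop :=
  exists v w, [/\ v != w, p = [fset v; w],
                  is_vertex P v, is_vertex P w & antipodal P v w].

Definition is_antipodal_edge_pair P (s : {fset {fset pt}}) : Prop :=
  exists e f, [/\ e != f, s = [fset e; f],
                  is_edge P e, is_edge P f &
                  antipodal P (midpoint e) (midpoint f)].

(* fset_set A is the finite set with the elements of A, for A finite; the
   three sets below are finite when P is a convex polyhedron. *)
Definition vertices P : {fset pt} := fset_set (is_vertex P).
Definition antipodal_vertex_pairs P : {fset {fset pt}} :=
  fset_set (is_antipodal_vertex_pair P).
Definition antipodal_edge_pairs P : {fset {fset {fset pt}}} :=
  fset_set (is_antipodal_edge_pair P).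

Definition nV P : nat := #|` vertices P|.
Definition nA P : nat := #|` antipodal_vertex_pairs P|.
Definition nB P : nat := #|` antipodal_edge_pairs P|.

Definition antipodal_defect P : int :=
  (nV P)%:Z - 1 - (nA P)%:Z + (nB P)%:Z.

End Polyhedra.

(* A finite two-dimensional CW complex whose 1-skeleton is a simple graph:
   the 1-cells are two-element sets of vertices, and each 2-cell c is a
   polygon attached along the closed walk attach c. *)
Record complex2 (T : choiceType) := Complex2 {
  cells0 : {fset T};
  cells1 : {fset {fset T}};
  cells2 : finType;
  attach : cells2 -> seq T }.

Definition complex2_wf (T : choiceType) (X : complex2 T) : Prop :=
  (forall p, p \in cells1 X -> exists v w,
     [/\ v != w, p = [fset v; w], v \in cells0 X & w \in cells0 X]) /\
  (forall c : cells2 X, attach c != [::] /\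
     cycle (fun v w => [fset v; w] \in cells1 X) (attach c)).

Section CellularHomology.
Variables (T : choiceType) (X : complex2 T).

Definition cells (k : nat) : finType :=
  match k with
  | 0 => cells0 X
  | 1 => cells1 X
  | 2 => cells2 X
  | _ => void
  end.

(* The 1-cell p is oriented from its first to its second element in the
   canonical enumeration of p. *)
Definition vertex_incidence (p : {fset T}) (v : T) : rat :=
  if v \in p then (if index v p == 0%N then -1 else 1) else 0.

Definition step_incidence (p : {fset T}) (a b : T) : rat :=
  if [fset a; b] == p then (if (index a p < index b p)%N then 1 else -1)
  else 0.

Definition walk_incidence (s : seq T) (p : {fset T}) : rat :=
  \sum_(ab <- zip s (rot 1 s)) step_incidence p ab.1 ab.2.

Definition incidence (k : nat) : cells k.+1 -> cells k -> rat :=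
  match k with
  | 0 => fun p v => vertex_incidence (val p) (val v)
  | 1 => fun c p => walk_incidence (attach c) (val p)
  | _ => fun _ _ => 0
  end.

(* Cellular boundary C_(k+1) -> C_k, acting on row vectors. *)
Definition boundary (k : nat) : 'M[rat]_(#|cells k.+1|, #|cells k|) :=
  \matrix_(i, j) incidence (enum_val i) (enum_val j).

Definition cycle_space (k : nat) : 'M[rat]_#|cells k| :=
  match k with
  | 0 => 1%:M
  | k'.+1 => kermx (boundary k')
  end.

(* The row space of Z :\: B is a complement of (Z :&: B) in Z, hence a copy
   of the k-th homology space. *)
Definition betti (k : nat) : nat :=
  \rank (cycle_space k :\: boundary k)%MS.

End CellularHomology.

Section SquareComplex.
Variable R : realType.
Local Notation pt := 'rV[R]_3.

(* For s = {e, f} with e = {v, v'} and f = {w, w'}: the closed walk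
   v - w - v' - w' - v; another labelling only changes its starting point
   and its direction. *)
Definition square_walk (s : {fset {fset pt}}) : seq pt :=
  let e : {fset pt} := nth fset0 s 0 in
  let f : {fset pt} := nth fset0 s 1 in
  [:: nth 0 e 0; nth 0 f 0; nth 0 e 1; nth 0 f 1].

Definition square_complex (P : set pt) : complex2 pt :=
  @Complex2 pt (vertices P) (antipodal_vertex_pairs P)
    (antipodal_edge_pairs P) (fun s => square_walk (val s)).

End SquareComplex.

Lemma fset2_enum (T : choiceType) (a b : T) : a != b ->
  enum_fset [fset a; b] = [:: a; b] \/ enum_fset [fset a; b] = [:: b; a].
Proof.
move=> ab.
have : perm_eq (enum_fset [fset a; b]) [:: a; b].
  apply: uniq_perm; rewrite ?fset_uniq //=; first by rewrite inE ab.
  by move=> x; rewrite !inE.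
move=> pe; have := perm_size pe; case: enum_fset pe => [|x [|y []]] // pe _.
have := perm_uniq pe; rewrite /= !inE ab /= andbT => xy.
have := perm_mem pe x; have := perm_mem pe y.
rewrite !inE !eqxx orbT /= => /esym/orP[]/eqP yE /esym/orP[]/eqP xE; subst x y;
  rewrite ?eqxx // in xy; by [left|right].
Qed.

Lemma step_vertex_incidence (T : choiceType) (a b v : T) : a != b ->
  step_incidence [fset a; b] a b * vertex_incidence [fset a; b] v =
  (b == v)%:R - (a == v)%:R.
Proof.
move=> ab; rewrite /step_incidence eqxx /vertex_incidence !inE.
rewrite ![v == _]eq_sym.
case: (eqVneq a v) => [<-|av]; rewrite ?[b == a]eq_sym ?(negbTE ab) /=.
  by case: (fset2_enum ab) => ->;
    rewrite /= ?eqxx ?(negbTE ab) ?[b == a]eq_sym ?(negbTE ab) /=; ring.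
case: (eqVneq b v) => [<-|bv] /=; last by rewrite mulr0 subr0.
by case: (fset2_enum ab) => ->;
  rewrite /= ?eqxx ?(negbTE ab) ?[b == a]eq_sym ?(negbTE ab) /=; ring.
Qed.

Lemma boundary_boundary (T : choiceType) (X : complex2 T) :
  complex2_wf X -> boundary X 1 *m boundary X 0 = 0.
Proof.
move=> [wf1 wf2]; apply/matrixP => i j; rewrite !mxE.
set c : cells2 X := enum_val i; set v : T := val (enum_val j).
have [_ cyc] := wf2 c.
under eq_bigr do rewrite !mxE /=.
rewrite -(big_enum_val (fun p : cells X 1 => walk_incidence (attach c) (val p) *
                       vertex_incidence (val p) v)) /=.
rewrite (eq_bigl predT) //.
under eq_bigr do rewrite /walk_incidence mulr_suml.
rewrite exchange_big /=.
have steps : all (fun ab => [fset ab.1; ab.2] \in cells1 X)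
               (zip (attach c) (rot 1 (attach c))).
  case: (attach c) cyc => [//|x s]; rewrite /= rot1_cons.
  elim: s {1 3}x => [|y s IH] z /=; first by rewrite andbT.
  by move=> /andP[-> /IH].
have E ab : ab \in zip (attach c) (rot 1 (attach c)) ->
    \sum_(p : cells1 X) step_incidence (val p) ab.1 ab.2 *
       vertex_incidence (val p) v = (ab.2 == v)%:R - (ab.1 == v)%:R.
  move=> /(allP steps) abX; have ab12 : ab.1 != ab.2.
    have [x [y [xy + _ _]]] := wf1 _ abX.
    move=> /(congr1 (fun A : {fset T} => #|` A|)); rewrite !cardfs2 xy.
    by case: eqP.
  rewrite (bigD1 [` abX]) //= step_vertex_incidence // big1 ?addr0 // => p pn.
  rewrite /step_incidence ifN ?mul0r //.
  by apply: contra pn => /eqP e; apply/eqP/val_inj.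
rewrite big_seq (eq_bigr _ E) -big_seq sumrB /=.
rewrite -(big_map snd predT (fun b => (b == v)%:R)).
rewrite -(big_map fst predT (fun b => (b == v)%:R)).
rewrite -/(unzip1 _) -/(unzip2 _) unzip1_zip ?unzip2_zip ?size_rot //.
by rewrite (perm_big (attach c)) ?subrr //= perm_rot.
Qed.

Section WellFormed.
Variable R : realType.
Local Notation pt := 'rV[R]_3.
Implicit Types (P F : set pt) (u v w x y z : pt) (e f : {fset pt}).

Lemma dotDr u x y : dot u (x + y) = dot u x + dot u y.
Proof. by rewrite /dot -big_split; apply: eq_bigr => i _; rewrite mxE mulrDr. Qed.
Lemma dotDl u v x : dot (u + v) x = dot u x + dot v x.
Proof. by rewrite /dot -big_split; apply: eq_bigr => i _; rewrite mxE mulrDl. Qed.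
Lemma dotZr u a x : dot u (a *: x) = a * dot u x.
Proof. by rewrite /dot mulr_sumr; apply: eq_bigr => i _; rewrite mxE mulrCA. Qed.
Lemma dotZl u a x : dot (a *: u) x = a * dot u x.
Proof. by rewrite /dot mulr_sumr; apply: eq_bigr => i _; rewrite mxE mulrA. Qed.
Lemma dot0r u : dot u 0 = 0.
Proof. by rewrite -(scale0r (0 : pt)) dotZr mul0r. Qed.
Lemma dot_sumr u n (a : 'I_n -> R) (p : 'I_n -> pt) :
  dot u (\sum_i a i *: p i) = \sum_i a i * dot u (p i).
Proof.
elim/big_rec2: _ => [|i y1 y2 _ <-]; first exact: dot0r.
by rewrite dotDr dotZr.
Qed.
Lemma dot_gt0 u : u != 0 -> 0 < dot u u.
Proof.
move=> u0; rewrite lt_def; apply/andP; split; last first.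
  by apply: sumr_ge0 => i _; rewrite -expr2 sqr_ge0.
apply: contra u0; rewrite psumr_eq0; last first.
  by move=> i _; rewrite -expr2 sqr_ge0.
move=> /allP H; apply/eqP/rowP => i; rewrite mxE; apply/eqP.
by have := H i (mem_index_enum i); rewrite mulf_eq0 orbb.
Qed.

Lemma conv_hull_gen n (p : 'I_n -> pt) i : conv_hull p (p i).
Proof.
exists (fun j => (j == i)%:R); split => [j||]; first by rewrite ler0n.
  by rewrite (bigD1 i) //= eqxx big1 ?addr0 // => j /negbTE ->.
by rewrite (bigD1 i) //= eqxx scale1r big1 ?addr0 // => j /negbTE ->; rewrite scale0r.
Qed.

Lemma conv_hull_max n (p : 'I_n -> pt) u M (a : 'I_n -> R) :
  (forall i, 0 <= a i) -> \sum_i a i = 1 ->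
  (forall i, dot u (p i) <= M) -> M <= dot u (\sum_i a i *: p i) ->
  forall i, a i != 0 -> dot u (p i) = M.
Proof.
move=> a0 a1 uM; rewrite dot_sumr => Mle i ai.
have H0 j : true -> 0 <= a j * (M - dot u (p j)).
  by move=> _; rewrite mulr_ge0 ?a0// subr_ge0.
have : \sum_j a j * (M - dot u (p j)) = 0.
  apply/le_anti; rewrite sumr_ge0 // andbT.
  under eq_bigr do rewrite mulrBr.
  by rewrite sumrB -mulr_suml a1 mul1r subr_le0.
move/eqP; rewrite psumr_eq0 // => /allP /(_ i (mem_index_enum i)).
by rewrite mulf_eq0 (negbTE ai) /= subr_eq0 => /eqP.
Qed.

Lemma vertex_gen n (p : 'I_n -> pt) v :
  is_vertex (conv_hull p) v -> exists i, v = p i.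
Proof.
move=> [_ [u E]].
have [Pv maxv] : conv_hull p v /\ forall y, conv_hull p y -> dot u y <= dot u v.
  by have : [set v] v by []; rewrite E.
case: (Pv) => a [a0 a1 av].
have [i ai] : exists i, a i != 0.
  apply/not_existsP => H; have := oner_neq0 R; rewrite -a1 big1 ?eqxx // => i _.
  by apply/eqP; have := H i; case: (a i == 0).
exists i; suff : [set v] (p i) by move=> <-.
rewrite E; split=> [|y Py]; first exact: conv_hull_gen.
rewrite (@conv_hull_max n p u (dot u v) a) // => [|j|]; first exact: maxv.
- exact/maxv/conv_hull_gen.
- by rewrite -av.
Qed.

Lemma small_eps n (b c : 'I_n -> R) : exists2 eps : R, 0 < eps &
  forall i, 0 < c i -> eps * b i < c i.
Proof.
exists (\big[Num.min/1]_(i | 0 < c i) (c i / (`|b i| + 1))).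
  by apply: lt_bigmin => // i ci; rewrite divr_gt0 // ltr_wpDl.
move=> i ci; set eps := \big[_/_]_(_ | _) _.
have e0 : 0 < eps by apply: lt_bigmin => // j cj; rewrite divr_gt0 // ltr_wpDl.
have : eps <= c i / (`|b i| + 1) by exact: bigmin_le_cond.
rewrite ler_pdivlMr ?ltr_wpDl // mulrDr mulr1 => H.
by have := ler_norm (b i); nra.
Qed.

Lemma segmentC v w : segment v w = segment w v.
Proof.
have H v' w' : segment v' w' `<=` segment w' v'.
  move=> x [t /andP[t0 t1] ->]; exists (1 - t); first by lra.
  by rewrite opprB addrCA subrr addr0 addrC.
by apply/seteqP; split.
Qed.

Lemma edge_end n (p : 'I_n -> pt) v w : v != w ->
  is_face (conv_hull p) (segment v w) -> is_vertex (conv_hull p) v.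
Proof.
move=> vw [_ [u E]].
have sv : segment v w v.
  by exists 0; rewrite ?lexx ?ler01 // subr0 scale1r scale0r addr0.
have [Pv maxv] : conv_hull p v /\ forall y, conv_hull p y -> dot u y <= dot u v.
  by rewrite E in sv.
have [d dE] : exists d, d = v - w by exists (v - w).
have d0 : 0 < dot d d by apply: dot_gt0; rewrite dE subr_eq0.
have [eps e0 He] := small_eps (fun i => dot d (p i) - dot d v)
  (fun i => dot u v - dot u (p i)).
split; first by exists v.
pose u' := u + eps *: d; exists u'.
have gen i : dot u' (p i) <= dot u' v /\ (dot u' (p i) = dot u' v -> p i = v).
  have := maxv _ (conv_hull_gen p i); rewrite le_eqVlt => /orP[/eqP eq|lt].
    have : segment v w (p i).
      rewrite E; split => [|y Py]; first exact: conv_hull_gen.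
      by rewrite eq; exact: maxv.
    move=> [t /andP[t0 t1] pE].
    have {}pE : p i = v + (- t) *: d.
      by rewrite pE dE scalerBl scale1r scaleNr scalerBr opprB addrA addrAC.
    have : dot u' (p i) = dot u' v + eps * - t * dot d d.
      by rewrite /u' !dotDl !dotZl eq; rewrite {1}pE dotDr dotZr; ring.
    have K0 : 0 <= eps * t * dot d d.
      by apply: mulr_ge0; [apply: mulr_ge0 => //; exact: ltW|exact: ltW].
    move=> ->; split; first by lra.
    move=> H; suff -> : p i = v by [].
    have : t * (eps * dot d d) = 0 by lra.
    move/eqP; rewrite !mulf_eq0 (gt_eqF e0) (gt_eqF d0) !orbF => /eqP t00.
    by rewrite pE t00 oppr0 scale0r addr0.
  have := He i; rewrite subr_gt0 => /(_ lt) H.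
  have {}H : dot u' (p i) < dot u' v by rewrite /u' !dotDl !dotZl; lra.
  split; first exact: ltW.
  by move=> H'; move: H; rewrite H' ltxx.
have mx y : conv_hull p y -> dot u' y <= dot u' v.
  move=> [a [a0 a1 ->]]; rewrite dot_sumr -[leRHS]mul1r -a1 mulr_suml.
  by apply: ler_sum => i _; apply: ler_wpM2l; rewrite ?a0 //; case: (gen i).
apply/seteqP; split => x /= => [->//|[Px maxx]].
case: Px => a [a0 a1 xE]; rewrite xE -[RHS]scale1r -a1 scaler_suml.
apply: eq_bigr => i _; have [->|ai] := eqVneq (a i) 0; first by rewrite !scale0r.
congr (_ *: _); apply: (gen i).2.
apply: (@conv_hull_max n p u' (dot u' v) a) => // [j|]; first by case: (gen j).
by rewrite -xE; exact: maxx.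
Qed.

Lemma full_dim P u c : interior P !=set0 -> u != 0 ->
  (forall z, P z -> dot u z = c) -> False.
Proof.
move=> [x Px] u0 H.
have cv : (fun s : R => x + s *: u) @ (0 : R) --> x + (0 : R) *: u.
  apply: cvgD; first exact: cvg_cst.
  by apply: cvgZr_tmp; exact: cvg_id.
rewrite scale0r addr0 in cv.
have /nbhs_ballP[r /= r0 br] := cv _ Px.
have Pr : P (x + (r / 2) *: u).
  apply: (br (r / 2)); rewrite /ball /= sub0r normrN gtr0_norm; lra.
have := H _ Pr; rewrite dotDr dotZr (H _ (interior_subset Px)).
have := dot_gt0 u0; nra.
Qed.

Lemma midpoint2 v w : v != w -> midpoint [fset v; w] = 2^-1 *: (v + w).
Proof.
move=> vw; rewrite /midpoint; congr (_ *: _).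
by case: (fset2_enum vw) => ->; rewrite !big_cons big_nil addr0 // addrC.
Qed.

Lemma antipodalC P x y : antipodal P x y -> antipodal P y x.
Proof.
move=> [Px Py [u u0 H]]; split => //; exists (- u); rewrite ?oppr_eq0 //.
by move=> z /H; rewrite -scaleN1r !dotZl; lra.
Qed.

Lemma face_sub P F : is_face P F -> F `<=` P.
Proof. by move=> [_ [u ->]] x []. Qed.

Lemma seg_l v w : segment v w v.
Proof. by exists 0; rewrite ?lexx ?ler01 // subr0 scale1r scale0r addr0. Qed.

Lemma edge_sub P e x : is_edge P e -> x \in e -> P x.
Proof.
move=> [v [w [_ -> F]]]; rewrite !inE => /orP[]/eqP ->.
  exact/(face_sub F)/seg_l.
by apply/(face_sub F); rewrite segmentC; exact: seg_l.
Qed.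

Lemma edge_vertex n (p : 'I_n -> pt) e x :
  is_edge (conv_hull p) e -> x \in e -> is_vertex (conv_hull p) x.
Proof.
move=> [v [w [vw -> F]]]; rewrite !inE => /orP[]/eqP ->; first exact: (edge_end vw).
by apply: (@edge_end n p w v); rewrite 1?eq_sym // segmentC.
Qed.

Lemma antipodal_ends P e f v w : is_edge P e -> is_edge P f ->
  antipodal P (midpoint e) (midpoint f) -> v \in e -> w \in f -> antipodal P v w.
Proof.
move=> Ee Ef [_ _ [u u0 H]] ve wf; split; [exact: (edge_sub Ee)|exact: (edge_sub Ef)|].
exists u => //.
have [Hv Hw] : dot u v = dot u (midpoint e) /\ dot u w = dot u (midpoint f).
  have He x : x \in e -> dot u x <= dot u (midpoint e).
    by move=> /(edge_sub Ee)/H/andP[].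
  have Hf x : x \in f -> dot u (midpoint f) <= dot u x.
    by move=> /(edge_sub Ef)/H/andP[].
  case: Ee Ef ve wf He Hf => [v1 [v2 [v12 -> _]]] [w1 [w2 [w12 -> _]]].
  rewrite !midpoint2 // !dotZr !dotDr => ve wf He Hf.
  have := He v1; have := He v2; have := Hf w1; have := Hf w2.
  rewrite !inE !eqxx ?orbT => /(_ isT) + /(_ isT) + /(_ isT) + /(_ isT).
  move: ve wf; rewrite !inE => /orP[]/eqP -> /orP[]/eqP -> *; split; lra.
by move=> z; rewrite Hv Hw; exact: H.
Qed.

Lemma antipodal_neq P v : interior P !=set0 -> ~ antipodal P v v.
Proof.
move=> iP [_ _ [u u0 H]]; apply: (full_dim iP u0 (c := dot u v)) => z /H.
by move=> /le_anti.
Qed.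

Lemma finite_vertices P : convex_polyhedron P -> finite_set (is_vertex P).
Proof.
move=> [[n [p ->]] _]; apply: (@sub_finite_set _ _ (range p)).
  by move=> v /vertex_gen[i ->]; exists i.
exact/finite_image/finite_finset.
Qed.

Lemma finite_pairs (T : choiceType) (A : set T) (B : set {fset T}) :
  finite_set A ->
  (forall p, B p -> exists v w : T, [/\ p = [fset v; w], A v & A w]) -> finite_set B.
Proof.
move=> fA H.
apply: (@sub_finite_set _ _ [set [fset v; w] | v in A & w in A]).
  by move=> p /H[v [w [-> Av Aw]]]; exists v => //; exists w.
exact: finite_image2.
Qed.

Lemma finite_antipodal_vertex_pairs P : convex_polyhedron P ->
  finite_set (is_antipodal_vertex_pair P).
Proof.
move=> hP; apply: (finite_pairs (finite_vertices hP)).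
by move=> p [v [w [_ -> vV wV _]]]; exists v, w.
Qed.

Lemma finite_edges P : convex_polyhedron P -> finite_set (is_edge P).
Proof.
move=> hP; apply: (finite_pairs (finite_vertices hP)) => e Ee.
case: (Ee) => v [w [_ eE _]]; exists v, w.
case: hP Ee => [[n [p ->]] _] Ee.
by split => //; apply: (edge_vertex Ee); rewrite eE !inE eqxx ?orbT.
Qed.

Lemma finite_antipodal_edge_pairs P : convex_polyhedron P ->
  finite_set (is_antipodal_edge_pair P).
Proof.
move=> hP; apply: (finite_pairs (finite_edges hP)).
by move=> s [e [f [_ -> eE fE _]]]; exists e, f.
Qed.

Lemma square_complex_wf P : convex_polyhedron P -> complex2_wf (square_complex P).
Proof.
move=> hP; split => [p|s] /=.
  rewrite (in_fset_set (finite_antipodal_vertex_pairs hP)) inE.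
  move=> [v [w [vw pE vV wV _]]]; exists v, w.
  by rewrite !(in_fset_set (finite_vertices hP)) !inE; split=> //; apply/asboolP.
split => //.
have step e f x y : is_edge P e -> is_edge P f ->
    antipodal P (midpoint e) (midpoint f) -> x \in e -> y \in f ->
    [fset x; y] \in antipodal_vertex_pairs P.
  move=> Ee Ef Aef xe yf; have Axy := antipodal_ends Ee Ef Aef xe yf.
  rewrite (in_fset_set (finite_antipodal_vertex_pairs hP)) inE; exists x, y.
  case: (hP) => [[n [p PE]] iP]; rewrite PE in Ee Ef; split => //.
  - by apply/eqP => xy; move: Axy; rewrite xy; exact: antipodal_neq.
  - by rewrite PE; exact: (edge_vertex Ee).
  - by rewrite PE; exact: (edge_vertex Ef).
have ends e : is_edge P e -> nth 0 e 0 \in e /\ nth 0 e 1 \in e.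
  case=> v [w [vw -> _]]; rewrite !inE.
  by case: (fset2_enum vw) => ->; rewrite /= !eqxx ?orbT.
have := valP s.
rewrite (in_fset_set (finite_antipodal_edge_pairs hP)) inE.
move=> [e [f [ef sE Ee Ef Aef]]]; rewrite sE /square_walk.
have Afe := antipodalC Aef.
have [e0 e1] := ends _ Ee; have [f0 f1] := ends _ Ef.
case: (fset2_enum ef) => -> /=; rewrite andbT;
 apply/and4P; split; solve [exact: (step e f)|exact: (step f e)].
Qed.
End WellFormed.

(* Main.v *)
(* Over Q it suffices to show that X(P) is connected and has no first
   cohomology: the ranks of the two boundary maps are then V - 1 and A - V + 1,
   which gives beta_2 = B - A + V - 1.

   Let c be a cochain on the antipodal graph vanishing on the squares. For
   vertices v, x of a proper face F(u), the difference c(v,w) - c(x,w) does not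
   depend on the vertex w antipodal to both: this is the square relation summed
   along edge paths in F(u) and F(-u), and then propagated by moving u. These
   differences are the differences of a potential psi on the vertices; psi is
   built downwards along a generic functional g, and well-definedness at a
   vertex v holds because the neighbours of v above v are linked, within proper
   faces containing v, to one another. Finally kappa(v,w) = c(v,w) - psi(v) +
   psi(w) is constant on ordered antipodal pairs, since such pairs are linked by
   moving u on the sphere; as kappa is antisymmetric, it vanishes, so c is the
   coboundary of psi. *)
Require Import Defs.
From mathcomp Require Import ring lra.

Set Implicit Arguments.
Unset Strict Implicit.
Unset Printing Implicit Defensive.

Import Order.TTheory GRing.Theory Num.Theory.
Local Open Scope classical_set_scope.
Local Open Scope ring_scope.

(** * Sweeping through a segment of affine functions *)

Lemma exists_max (R : realDomainType) (T : eqType) (s : seq T) (f : T -> R) x0 :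
  x0 \in s -> exists2 x, x \in s & forall y, y \in s -> f y <= f x.
Proof.
elim: s x0 => // a s IH x0 _; case: s IH => [|b s] IH.
  by exists a => [|y]; rewrite inE // => /eqP ->.
have [x xs xm] := IH b (mem_head _ _).
have [le|lt] := leP (f a) (f x).
  by exists x => [|y]; rewrite inE ?xs ?orbT // => /orP[/eqP->//|/xm].
exists a => [|y]; first exact: mem_head.
by rewrite inE => /orP[/eqP->//|/xm] /le_trans; apply; exact: ltW.
Qed.

Lemma small_eps_seq (R : realType) (T : eqType) (s : seq T) (b c : T -> R) :
  exists2 eps : R, 0 < eps & forall x, x \in s -> 0 < c x -> eps * b x < c x.
Proof.
have [eps e0 H] := small_eps (fun i => b (tnth (in_tuple s) i))
  (fun i => c (tnth (in_tuple s) i)).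
by exists eps => // x /seq_tnthP[i ->]; exact: H.
Qed.

Section Sweep.
Variables (R : realFieldType) (T : eqType) (f g : T -> R) (S : T -> Prop).

Definition maximal_at (s : seq T) (t : R) (i : T) : Prop :=
  i \in s /\ forall j, j \in s ->
    (1 - t) * f j + t * g j <= (1 - t) * f i + t * g i.

(* At the crossing time of the affine functions of [i] and [j], a strictly
   larger third function replaces one of them on a shorter interval, on which
   the replaced function stays below the other one and can be discarded. *)
Lemma sweep_interval (s : seq T) a b i j : a <= b ->
  (forall t k l, a <= t <= b -> maximal_at s t k -> maximal_at s t l -> S k -> S l) ->
  maximal_at s a i -> maximal_at s b j -> S i -> S j.
Proof.
move: {2}(size s) (leqnn (size s)) => n.
elim: n s a b i j => [|n IH] s a b i j sn ab cl ai bj Si.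
  by case: ai; case: s sn {cl bj}.
apply: contrapT => nSj.
have [[si im] [sj jm]] := (ai, bj).
pose h k t : R := (1 - t) * f k + t * g k.
have ha : h j a <= h i a by exact: im.
have hb : h i b <= h j b by exact: jm.
have {}ha : h j a < h i a.
  rewrite lt_neqAle ha andbT; apply/eqP => e; apply: nSj.
  apply: (cl a i) => //; first by rewrite lexx ab.
  by split=> // k /im; rewrite -!/(h _ _) e.
have dd : 0 < h i a - h j a - (h i b - h j b) by lra.
pose t1 := a + (h i a - h j a) / (h i a - h j a - (h i b - h j b)) * (b - a).
have E : (h i a - h j a) / (h i a - h j a - (h i b - h j b)) *
  (h i a - h j a - (h i b - h j b)) = h i a - h j a by rewrite divfK // gt_eqF.
have l0 : 0 <= (h i a - h j a) / (h i a - h j a - (h i b - h j b)) <= 1.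
  by apply/andP; split; [apply: divr_ge0; lra|rewrite ler_pdivrMr // mul1r; lra].
have t1ab : a <= t1 <= b.
  move: l0 => /andP[l0 l1]; rewrite /t1; set la := _ / _ in l0 l1 *; nra.
have t1E : h i t1 = h j t1.
  apply/eqP; rewrite -subr_eq0; apply/eqP; rewrite /t1; move: E.
  rewrite -/t1; set la := _ / _ => E.
  have -> : h i (a + la * (b - a)) - h j (a + la * (b - a)) =
     h i a - h j a - la * (h i a - h j a - (h i b - h j b)) by rewrite /h; ring.
  by rewrite E subrr.
have [m slope] : exists m : R, forall t t',
    h i t' - h j t' = h i t - h j t + (t' - t) * m.
  by exists (g i - f i - g j + f j) => t t'; rewrite /h; ring.
have m0 : m <= 0.
  rewrite leNgt; apply/negP => m0; have := slope a b.
  have : 0 <= (b - a) * m by apply: mulr_ge0; lra.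
  lra.
have ij : i != j by apply/eqP => ij; apply: nSj; rewrite -ij.
have [k ks km] := @exists_max _ _ s (h ^~ t1) i si.
(* Otherwise [i] and [j] would both be maximal at [t1], and [S] would pass from one to the other
   there. *)
have nij : ~ (h k t1 <= h i t1).
  move=> kle; apply: nSj; apply: (cl t1 i) => //; split=> // l /km; rewrite -!/(h _ _).
    by move=> /le_trans; apply.
  by rewrite -t1E; move=> /le_trans; apply.
have ki : k != i by apply/eqP => ki; apply: nij; rewrite ki.
have kj : k != j by apply/eqP => kj; apply: nij; rewrite kj t1E.
have small x : x \in s -> (size (seq.filter (predC1 x) s) <= n)%N.
  move=> xs; rewrite -ltnS; apply: leq_trans sn.
  rewrite size_filter -(count_predC (predC1 x)) -addn1 leq_add2l -has_count.
  by apply/hasP; exists x => //=; rewrite eqxx.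
case/andP: t1ab => at1 t1b.
have [Sk|nSk] := pselect (S k).
  apply/nSj/(IH (seq.filter (predC1 i) s) t1 b k j (small _ si) t1b _ _ _ Sk).
  - move=> t x y /andP[tt1 tb] [xs xm] [ys ym].
    have hle : h i t <= h j t by have := slope t1 t; nra.
    apply: (cl t); first by rewrite tb (le_trans at1).
      move: xs; rewrite mem_filter => /andP[_ xs]; split=> // z zs.
      have [->|zi] := eqVneq z i.
        by apply: (le_trans hle); apply: xm; rewrite mem_filter /= eq_sym ij.
      by apply: xm; rewrite mem_filter /= zi.
    move: ys; rewrite mem_filter => /andP[_ ys]; split=> // z zs.
    have [->|zi] := eqVneq z i.
      by apply: (le_trans hle); apply: ym; rewrite mem_filter /= eq_sym ij.
    by apply: ym; rewrite mem_filter /= zi.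
  - by split=> [|z]; rewrite mem_filter /= ?ki // => /andP[_ /km].
  - by split=> [|z]; rewrite mem_filter /= 1?eq_sym ?ij // => /andP[_ /jm].
apply/nSk/(IH (seq.filter (predC1 j) s) a t1 i k (small _ sj) at1 _ _ _ Si).
- move=> t x y /andP[ta tt1] [xs xm] [ys ym].
  have hle : h j t <= h i t by have := slope t1 t; nra.
  apply: (cl t); first by rewrite ta (le_trans tt1).
    move: xs; rewrite mem_filter => /andP[_ xs]; split=> // z zs.
    have [->|zj] := eqVneq z j.
      by apply: (le_trans hle); apply: xm; rewrite mem_filter /= ij.
    by apply: xm; rewrite mem_filter /= zj.
  move: ys; rewrite mem_filter => /andP[_ ys]; split=> // z zs.
  have [->|zj] := eqVneq z j.
    by apply: (le_trans hle); apply: ym; rewrite mem_filter /= ij.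
  by apply: ym; rewrite mem_filter /= zj.
- by split=> [|z]; rewrite mem_filter /= ?ij // => /andP[_ /im].
- by split=> [|z]; rewrite mem_filter /= ?kj // => /andP[_ /km].
Qed.

End Sweep.

(** * Faces of an exposed configuration of points *)

Lemma maximal_at0 (R : realFieldType) (T : eqType) (f g : T -> R) s i : i \in s ->
  (forall j, j \in s -> f j <= f i) -> maximal_at f g s 0 i.
Proof. by move=> si H; split=> // j /H; rewrite !mul0r !addr0 subr0 !mul1r. Qed.

Lemma maximal_at1 (R : realFieldType) (T : eqType) (f g : T -> R) s i : i \in s ->
  (forall j, j \in s -> g j <= g i) -> maximal_at f g s 1 i.
Proof. by move=> si H; split=> // j /H; rewrite subrr !mul0r !add0r !mul1r. Qed.

Lemma count_lt (T : eqType) (P Q : pred T) s z :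
  (forall x, P x -> Q x) -> z \in s -> Q z -> ~~ P z -> (count P s < count Q s)%N.
Proof.
move=> PQ zs Qz Pz.
have -> : count P s = count (predI Q P) s.
  by apply: eq_count => x /=; case: (boolP (P x)) => [/PQ->|]; rewrite ?andbF.
have -> : count Q s = (count (predI Q P) s + count (predD Q P) s)%N.
  rewrite -[LHS]size_filter -(count_predC P) !count_filter.
  by congr (_ + _)%N; apply: eq_count => x /=; rewrite andbC.
by rewrite -addn1 leq_add2l -has_count; apply/hasP; exists z => //=; rewrite Pz.
Qed.

(** * Scalar products and generic functionals *)

Section DotProduct.
Variable R : realType.
Implicit Types u v w x y : 'rV[R]_3.

Lemma dotC u x : dot u x = dot x u.
Proof. by apply: eq_bigr => i _; rewrite mulrC. Qed.

Lemma dotNl u x : dot (- u) x = - dot u x.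
Proof. by rewrite -scaleN1r dotZl mulN1r. Qed.

Lemma dotNr u x : dot u (- x) = - dot u x.
Proof. by rewrite -scaleN1r dotZr mulN1r. Qed.

Lemma dot0l x : dot 0 x = 0.
Proof. by rewrite dotC dot0r. Qed.

Lemma orthogonal2 u v : exists q, [/\ q != 0, dot q u = 0 & dot q v = 0].
Proof.
pose A := row_mx u^T v^T; pose q := nz_row (kermx A).
have q0 : q != 0.
  rewrite nz_row_eq0 -mxrank_eq0 mxrank_ker -lt0n subn_gt0.
  by apply: leq_ltn_trans (rank_leq_col A) _.
have : q *m A = 0 by apply/sub_kermxP; exact: nz_row_sub.
rewrite mul_mx_row -[0]hsubmxK => /eq_row_mx[].
rewrite !linear0 => qu qv.
have dotE x : q *m x^T = 0 -> dot q x = 0.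
  move=> /matrixP/(_ 0 0); rewrite !mxE => <-.
  by apply: eq_bigr => i _; rewrite mxE.
by exists q; rewrite !dotE.
Qed.

(** If [g] kills a nonzero [d], adding a small multiple of [d] itself repairs this, as
    [dot d d > 0], and keeps the earlier values nonzero. *)
Lemma generic_functional (s : seq 'rV[R]_3) :
  exists g, forall d, d \in s -> d != 0 -> dot g d != 0.
Proof.
elim: s => [|d s [g gs]]; first by exists 0.
have [d0|d0] := eqVneq d 0.
  by exists g => e; rewrite inE => /orP[/eqP->|/gs//]; rewrite d0 eqxx.
have [gd|gd] := eqVneq (dot g d) 0; last first.
  by exists g => e; rewrite inE => /orP[/eqP->|/gs].
have [eps e0 es] := small_eps_seq s (fun e => `|dot d e|) (fun e => `|dot g e|).
exists (g + eps *: d) => e; rewrite inE dotDl dotZl => /orP[/eqP-> _|es' e1].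
  by rewrite gd add0r mulf_neq0 // gt_eqF // dot_gt0.
have := es _ es'; rewrite normr_gt0 gs // => /(_ isT).
rewrite -{1}(gtr0_norm e0) -normrM; apply: contraTneq => /eqP.
by rewrite addr_eq0 => /eqP->; rewrite normrN ltxx.
Qed.

Definition interpolate (t : R) u v := (1 - t) *: u + t *: v.

Lemma dot_interpolate t u v x :
  dot (interpolate t u v) x = (1 - t) * dot u x + t * dot v x.
Proof. by rewrite dotDl !dotZl. Qed.

Lemma interpolateN t u v : interpolate t (- u) (- v) = - interpolate t u v.
Proof. by rewrite /interpolate !scalerN -opprD. Qed.

End DotProduct.

Section Configuration.
Variables (R : realType) (W : seq 'rV[R]_3).
Implicit Types u v w x y z : 'rV[R]_3.
(** [W] stands for the vertex list of a polyhedron: convex position enters through [exposedW], full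
    dimension through [fullW]. *)
Hypothesis exposedW : forall v, v \in W ->
  exists a, forall w, w \in W -> w != v -> dot a w < dot a v.
Hypothesis fullW : forall u c, (forall w, w \in W -> dot u w = c) -> u = 0.

Definition maximizes u v := (v \in W) && all (fun w => dot u w <= dot u v) W.

Lemma maximizesP u v :
  reflect (v \in W /\ forall w, w \in W -> dot u w <= dot u v) (maximizes u v).
Proof. by apply: (iffP andP) => [[vW /allP]|[vW /allP]]. Qed.

(** Encodes an edge through the vertices alone; [edge_polyhedron] recovers the geometric edge. *)
Definition abstract_edge v w :=
  [/\ v != w, v \in W & w \in W] /\
  exists u, forall x, x \in W -> maximizes u x = (x == v) || (x == w).

Lemma exists_maximizes u : exists v, maximizes u v.
Proof.
have [x xW] : exists x, x \in W.
  case: W fullW => [|x s] H; last by exists x; exact: mem_head.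
  have : const_mx 1 = 0 :> 'rV[R]_3 by apply: (H _ 0).
  by move=> /rowP/(_ 0); rewrite !mxE => /eqP; rewrite oner_eq0.
have [v vW vm] := exists_max (dot u) xW.
by exists v; apply/maximizesP.
Qed.

Lemma maximizes_eq u v x : maximizes u v -> maximizes u x -> dot u v = dot u x.
Proof.
move=> /maximizesP[vW vm] /maximizesP[xW xm].
by apply/le_anti; rewrite vm // xm.
Qed.

Lemma maximizes_interpolate t u u' v : 0 <= t <= 1 ->
  maximizes u v -> maximizes u' v -> maximizes (interpolate t u u') v.
Proof.
move=> /andP[t0 t1] /maximizesP[vW um] /maximizesP[_ um'].
apply/maximizesP; split=> // w wW; rewrite !dot_interpolate.
by have := um _ wW; have := um' _ wW; nra.
Qed.

(** Were the combination 0 with [t != 1], [u] would be a nonpositive multiple of [u'], so the common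
    maximizer [v] would also minimize [u], making [u] constant on [W]. *)
Lemma interpolate_neq0 t u u' v : 0 <= t <= 1 -> u != 0 -> u' != 0 ->
  maximizes u v -> maximizes u' v -> interpolate t u u' != 0.
Proof.
move=> /andP[t0 t1] u0 u'0 /maximizesP[vW um] /maximizesP[_ um'].
apply/negP => /eqP E.
have D w : (1 - t) * dot u w + t * dot u' w = 0.
  by rewrite -dot_interpolate E dot0l.
have [tE|tn] := eqVneq t 1.
  move: u'0; rewrite (fullW (u := u') (c := 0)) ?eqxx // => w wW.
  by have := D w; rewrite tE; lra.
move: u0; rewrite (fullW (u := u) (c := dot u v)) ?eqxx // => w wW.
have t1' : 0 < 1 - t by rewrite subr_gt0 lt_neqAle tn.
apply/le_anti; rewrite um //=.
have := D w; have := D v; have := um' _ wW; move=> A B C.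
have : 0 <= t * (dot u' v - dot u' w) by rewrite mulr_ge0 // subr_ge0.
move=> K; rewrite -(ler_pM2l t1'); lra.
Qed.

Lemma maximal_atP t u u' v :
  maximal_at (dot u) (dot u') W t v <-> maximizes (interpolate t u u') v.
Proof.
split=> [[vW vm]|/maximizesP[vW vm]].
  by apply/maximizesP; split=> // w /vm; rewrite !dot_interpolate.
by split=> // w /vm; rewrite !dot_interpolate.
Qed.

(** Carries a property from one face to another, provided it spreads inside each face met along the
    segment of functionals. *)
Lemma sweep_functional u u' (S : 'rV[R]_3 -> Prop) v v' :
  (forall t x y, 0 <= t <= 1 -> maximizes (interpolate t u u') x ->
     maximizes (interpolate t u u') y -> S x -> S y) ->
  maximizes u v -> maximizes u' v' -> S v -> S v'.
Proof.
move=> cl /maximizesP[vW vm] /maximizesP[v'W vm'].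
apply: (sweep_interval (f := dot u) (g := dot u') (s := W) ler01) => [t k l t01||].
- by rewrite !maximal_atP; exact: cl.
- exact: maximal_at0.
- exact: maximal_at1.
Qed.

(* [u] perturbed infinitesimally in the direction of [b]. *)
Lemma face_refine u b : exists u', forall x, maximizes u' x <->
  maximizes u x /\ forall w, maximizes u w -> dot b w <= dot b x.
Proof.
pose pairs := [seq (x, y) | x <- W, y <- W].
have inP x y : x \in W -> y \in W -> (x, y) \in pairs.
  by move=> xW yW; apply: allpairs_f.
have [eps e0 es] := small_eps_seq pairs
  (fun p => dot b p.1 - dot b p.2) (fun p => dot u p.2 - dot u p.1).
have {}es x y : x \in W -> y \in W -> dot u x < dot u y ->
    eps * (dot b x - dot b y) < dot u y - dot u x.
  by move=> xW yW lt; apply: (es (x, y)); rewrite ?inP ?subr_gt0.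
exists (u + eps *: b) => x; split.
  move=> /maximizesP[xW xm].
  have ux : maximizes u x.
    apply/maximizesP; split=> // w wW; rewrite leNgt; apply/negP => lt.
    by have := es _ _ xW wW lt; have := xm _ wW; rewrite !dotDl !dotZl; lra.
  split=> // w uw; have := maximizes_eq ux uw; case/maximizesP: uw => wW _ E.
  have := xm _ wW; rewrite !dotDl !dotZl E lerD2l ler_pM2l //.
move=> [ux xm]; case/maximizesP: (ux) => xW xum; apply/maximizesP; split=> // w wW.
rewrite !dotDl !dotZl.
have := xum _ wW; rewrite le_eqVlt => /orP[/eqP E|lt].
  rewrite E lerD2l ler_pM2l //; apply: xm; apply/maximizesP; split=> // y yW.
  by rewrite E xum.
by have := es _ _ wW xW lt; lra.
Qed.

(** Neither [a] nor [b] is constant on [F], so [t] is interior and [b] is a decreasing affine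
    function of [a] on [F]: the strict maximum of [a] is the strict minimum of [b]. *)
Lemma opposite_functionals (F : pred 'rV[R]_3) a b x y t c :
  F x -> F y -> x != y -> 0 <= t <= 1 ->
  (forall z, F z -> z != x -> dot a z < dot a x) ->
  (forall z, F z -> z != y -> dot b z < dot b y) ->
  (forall z, F z -> dot (interpolate t a b) z = c) ->
  forall z, F z -> z != x -> dot b x < dot b z.
Proof.
move=> Fx Fy xy /andP[t0 t1] ax bY tc z Fz zx.
have D w : F w -> (1 - t) * (dot a w - dot a x) + t * (dot b w - dot b x) = 0.
  by move=> Fw; have := tc _ Fw; have := tc _ Fx; rewrite !dot_interpolate; lra.
have yx : y != x by rewrite eq_sym.
have A1 := ax _ Fy yx; have A2 := bY _ Fx xy; have A3 := ax _ Fz zx.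
have Dy := D _ Fy; have Dz := D _ Fz.
have t0' : 0 < t.
  by rewrite lt_neqAle t0 andbT eq_sym; apply/eqP => tE; rewrite tE in Dy; lra.
have t1' : 0 < 1 - t.
  rewrite lt_neqAle subr_ge0 t1 andbT; apply/eqP => tE.
  have {}tE : t = 1 by lra.
  by rewrite tE in Dy; lra.
rewrite -(ltr_pM2l t0').
have : 0 < (1 - t) * (dot a x - dot a z) by rewrite mulr_gt0 // subr_gt0.
lra.
Qed.

(* Two exposing functionals [a], [b] of points [x], [y] of the face are joined by
   a segment of functionals cutting out smaller faces, unless some interpolation
   is constant on the face; then [y] is the unique minimum of [a], and a third
   point can be used as an intermediate stop. *)
Lemma face_connected u (S : 'rV[R]_3 -> Prop) :
  (forall x y, maximizes u x -> maximizes u y -> abstract_edge x y -> S x -> S y) ->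
  forall x y, maximizes u x -> maximizes u y -> S x -> S y.
Proof.
move: {2}(count (maximizes u) W) (leqnn (count (maximizes u) W)) => n.
elim: n u => [|n IH] u cn ed x y ux uy.
  move: cn; rewrite leqNgt -has_count => /hasPn/(_ x).
  by case/maximizesP: (ux) => xW _ /(_ xW); rewrite ux.
pose degenerate a b := exists t c, [/\ 0 <= t <= 1 &
  forall z, maximizes u z -> dot (interpolate t a b) z = c].
have sweep v w a b : maximizes u v -> maximizes u w ->
    (forall z, z \in W -> z != v -> dot a z < dot a v) ->
    (forall z, z \in W -> z != w -> dot b z < dot b w) ->
    ~ degenerate a b -> S v -> S w.
  move=> uv uw av bw ndeg.
  have inF z : (z \in seq.filter (maximizes u) W) = maximizes u z.
    by rewrite mem_filter; case: (boolP (maximizes u z)) => //= /maximizesP[].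
  have le c z z' : (forall z', z' \in W -> z' != z -> dot c z' < dot c z) ->
      z' \in W -> dot c z' <= dot c z.
    by move=> H z'W; have [->//|ne] := eqVneq z' z; exact/ltW/H.
  apply: (sweep_interval (f := dot a) (g := dot b)
            (s := seq.filter (maximizes u) W) ler01).
  - move=> t k l t01 [kF km] [lF lm]; rewrite !inF in kF lF.
    have [u' u'E] := face_refine u (interpolate t a b).
    have u'u z : maximizes u' z -> maximizes u z by case/u'E.
    have u'k : maximizes u' k.
      by apply/u'E; split=> // z uz; rewrite !dot_interpolate; apply: km; rewrite inF.
    have u'l : maximizes u' l.
      by apply/u'E; split=> // z uz; rewrite !dot_interpolate; apply: lm; rewrite inF.
    apply: (IH u' _ _ k l u'k u'l) => [|z z' /u'u uz /u'u]; last exact: ed.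
    (* The face of [u'] is strictly smaller: otherwise the interpolation would be constant on the
       face of [u], the excluded degenerate case. *)
    have [z uz u'z] : exists2 z, maximizes u z & ~~ maximizes u' z.
      apply: contrapT => H; apply: ndeg; exists t, (dot (interpolate t a b) k).
      split=> // z uz; have u'z : maximizes u' z.
        by apply: contrapT => /negP u'z; apply: H; exists z.
      by case/u'E: u'z => _ /(_ _ kF); case/u'E: u'k => _ /(_ _ uz); lra.
    rewrite -ltnS; apply: leq_trans cn; apply: (count_lt u'u _ uz u'z).
    by case/maximizesP: uz.
  - by apply: maximal_at0 => [|z]; rewrite inF // => /maximizesP[zW _]; exact: le.
  - by apply: maximal_at1 => [|z]; rewrite inF // => /maximizesP[zW _]; exact: le.
have uW z : maximizes u z -> z \in W by case/maximizesP.
have [<-//|xy] := eqVneq x y.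
have yx : y != x by rewrite eq_sym.
have [a ax] := exposedW (uW _ ux); have [b bY] := exposedW (uW _ uy).
have [|nd] := pselect (degenerate a b); last exact: sweep nd.
move=> [t [c [t01 tc]]].
have [[z [uz zx zy]]|H] := pselect (exists z, [/\ maximizes u z, z != x & z != y]); last first.
  apply: ed => //; split; first by split=> //; exact: uW.
  exists u => z zW; apply/idP/orP => [uz|[]/eqP->//].
  have [_|zx] := eqVneq z x; first by left.
  have [_|zy] := eqVneq z y; first by right.
  by case: H; exists z.
have axF w : maximizes u w -> w != x -> dot a w < dot a x by move=> /uW; exact: ax.
have byF w : maximizes u w -> w != y -> dot b w < dot b y by move=> /uW; exact: bY.
have minx := opposite_functionals ux uy xy t01 axF byF tc.
have miny : forall z, maximizes u z -> z != y -> dot a y < dot a z.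
  apply: (opposite_functionals (t := 1 - t) (c := c) uy ux yx _ byF axF); first by lra.
  by move=> w /tc <-; rewrite !dot_interpolate; ring.
have [d dz] := exposedW (uW _ uz).
have dzF w : maximizes u w -> w != z -> dot d w < dot d z by move=> /uW; exact: dz.
have xz : x != z by rewrite eq_sym.
have yz : y != z by rewrite eq_sym.
(* If [(d, b)] were degenerate, [z] would be the minimum of [b], which is [x]; if [(a, d)] were, [z]
   would be the minimum of [a], which is [y]. *)
move=> Sx; apply: (sweep z y d b uz uy dz bY).
  move=> [s [e [s01 se]]].
  have := opposite_functionals uz uy zy s01 dzF byF se ux xz.
  by rewrite ltNge ltW // minx.
apply: (sweep x z a d ux uz ax dz) => //.
move=> [s [e [s01 se]]].
have s01' : 0 <= 1 - s <= 1 by lra.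
have se' w : maximizes u w -> dot (interpolate (1 - s) d a) w = e.
  by move=> /se <-; rewrite !dot_interpolate; ring.
have := opposite_functionals uz ux zx s01' dzF axF se' uy yz.
by rewrite ltNge ltW // miny.
Qed.

End Configuration.

(** * Cochains on antipodal pairs *)

Section Cochain.
Variables (R : realType) (W : seq 'rV[R]_3).
Implicit Types u v w x y z : 'rV[R]_3.
Hypothesis exposedW : forall v, v \in W ->
  exists a, forall w, w \in W -> w != v -> dot a w < dot a v.
Hypothesis fullW : forall u c, (forall w, w \in W -> dot u w = c) -> u = 0.

Local Notation maximizes := (maximizes W).

(* For each [u] between [u1] and [u2], add the largest multiple of [g] that keeps
   [v] maximal: [v] then shares a face with some point above it, and these points
   are the maximizers of the slopes [(dot u w - dot u v) / dot g (w - v)], which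
   are affine in [u]. The added functional must not cancel [u], so [g] is first
   tilted out of the plane of [u1] and [u2]. *)
Lemma maximizes_neighbour_sweep g v v1 v2 u1 u2 (S : 'rV[R]_3 -> Prop) :
  (forall w, w \in W -> dot g w = dot g v -> w = v) ->
  u1 != 0 -> u2 != 0 ->
  maximizes u1 v -> maximizes u1 v1 -> maximizes u2 v -> maximizes u2 v2 ->
  dot g v < dot g v1 -> dot g v < dot g v2 ->
  (forall u x y, u != 0 -> maximizes u v -> maximizes u x -> maximizes u y ->
    dot g v < dot g x -> dot g v < dot g y -> S x -> S y) ->
  S v1 -> S v2.
Proof.
move=> ginj u10 u20 u1v u1v1 u2v u2v2 gv1 gv2 cl.
have [q [q0 qu1 qu2]] := orthogonal2 u1 u2.
have [g' [g'q g'up g'dn]] : exists g', [/\ dot g' q != 0,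
    forall w, w \in W -> dot g v < dot g w -> dot g' v < dot g' w &
    forall w, w \in W -> dot g w <= dot g v -> dot g' w <= dot g' v].
  have [gq|gq] := eqVneq (dot g q) 0; last by exists g.
  have [eps e0 es] := small_eps_seq W
    (fun w => `|dot q w - dot q v|) (fun w => `|dot g w - dot g v|).
  exists (g + eps *: q); split.
  - by rewrite dotDl dotZl gq add0r mulf_neq0 ?gt_eqF // dot_gt0.
  - move=> w wW gvw; have := es _ wW; rewrite gtr0_norm ?subr_gt0 // => /(_ gvw).
    rewrite !dotDl !dotZl; have := ler_norm (- (dot q w - dot q v)).
    by rewrite normrN; nra.
  - move=> w wW; rewrite le_eqVlt => /orP[/eqP/(ginj _ wW)->//|gvw].
    have := es _ wW; rewrite distrC gtr0_norm ?subr_gt0 // => /(_ gvw).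
    rewrite !dotDl !dotZl; have := ler_norm (dot q w - dot q v).
    by nra.
pose up := [seq w <- W | dot g v < dot g w].
have upE w : (w \in up) = (w \in W) && (dot g v < dot g w).
  by rewrite mem_filter andbC.
have upP w : w \in up -> 0 < dot g' w - dot g' v.
  by rewrite upE => /andP[wW /(g'up _ wW)]; rewrite subr_gt0.
pose slope (u w : 'rV[R]_3) := (dot u w - dot u v) / (dot g' w - dot g' v).
have slope_le0 u w : maximizes u v -> w \in up -> slope u w <= 0.
  move=> /maximizesP[_ um] wup; rewrite /slope ler_pdivrMr ?upP // mul0r subr_le0.
  by apply: um; move: wup; rewrite upE => /andP[].
have slope0 u w : maximizes u v -> maximizes u w -> slope u w = 0.
  by move=> uv uw; rewrite /slope (maximizes_eq uv uw) subrr mul0r.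
have W1 : v1 \in up by rewrite upE gv1; case/maximizesP: u1v1 => ->.
have W2 : v2 \in up by rewrite upE gv2; case/maximizesP: u2v2 => ->.
apply: (sweep_interval (f := slope u1) (g := slope u2) (s := up) ler01).
- move=> t k l t01 [ku km] [lu lm].
  pose la := - ((1 - t) * slope u1 k + t * slope u2 k).
  have lE : - ((1 - t) * slope u1 l + t * slope u2 l) = la.
    by congr (- _); apply/le_anti; rewrite lm // km.
  pose u := interpolate t u1 u2 + la *: g'.
  have la0 : 0 <= la.
    case/andP: t01 => t0 t1.
    have := slope_le0 _ _ u1v ku; have := slope_le0 _ _ u2v ku; rewrite /la; nra.
  have uslope w : w \in up -> dot u w - dot u v =
      (dot g' w - dot g' v) * ((1 - t) * slope u1 w + t * slope u2 w + la).
    move=> /upP w0; have w1 : dot g' w - dot g' v != 0 by rewrite gt_eqF.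
    by rewrite /u !dotDl !dotZl /slope; field.
  have vW : v \in W by case/maximizesP: u1v.
  have uv : maximizes u v.
    apply/maximizesP; split=> // w wW.
    have [gvw|gwv] := ltP (dot g v) (dot g w).
      have wup : w \in up by rewrite upE wW.
      rewrite -subr_le0 uslope // pmulr_rle0 ?upP // -subr_ge0 /la.
      by have := km _ wup; lra.
    have := maximizes_interpolate t01 u1v u2v => /maximizesP[_ /(_ _ wW)].
    by rewrite /u !(dotDl _ (la *: g')) !dotZl; have := g'dn _ wW gwv; nra.
  have um w : w \in up -> - ((1 - t) * slope u1 w + t * slope u2 w) = la ->
      maximizes u w.
    move=> wup E; have := uslope _ wup; rewrite -E subrr mulr0 => /eqP.
    rewrite subr_eq0 => /eqP uw; case/maximizesP: uv => _ uvm.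
    move: wup; rewrite upE => /andP[wW _].
    by apply/maximizesP; split=> // z /uvm; rewrite uw.
  have upg w : w \in up -> dot g v < dot g w by rewrite upE => /andP[].
  apply: (cl u) => //; [|exact: um|exact: um|exact: upg|exact: upg].
  have iN := interpolate_neq0 fullW t01 u10 u20 u1v u2v.
  (* If [u] were 0, pairing with [q] would leave [la * dot g' q = 0], so [la = 0] and the
     interpolation itself would vanish. *)
  apply/negP => /eqP u0.
  have := dot0l q; rewrite -u0 /u dotDl dot_interpolate (dotC u1) (dotC u2) qu1 qu2.
  rewrite !mulr0 !add0r dotZl => /eqP; rewrite mulf_eq0 (negbTE g'q) orbF => /eqP l0.
  by move: u0; rewrite /u l0 scale0r addr0 => /eqP; rewrite (negbTE iN).
- by apply: maximal_at0 => // w wup; rewrite (slope0 u1 v1) // slope_le0.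
- by apply: maximal_at1 => // w wup; rewrite (slope0 u2 v2) // slope_le0.
Qed.

(** [c] is a 1-cochain on ordered antipodal pairs; [c_square] is the vanishing of its coboundary on
    the square v-w-x-y, with reversed sides rewritten by antisymmetry. *)
Variables (K : numDomainType) (c : 'rV[R]_3 -> 'rV[R]_3 -> K).
Hypothesis c_anti : forall u v w, u != 0 -> maximizes u v -> maximizes (- u) w ->
  c w v = - c v w.
Hypothesis c_square : forall u v x w y, u != 0 ->
  maximizes u v -> maximizes u x -> maximizes (- u) w -> maximizes (- u) y ->
  abstract_edge W v x -> abstract_edge W w y -> c v w - c x w = c v y - c x y.

(** The square relations telescope along edges from [w] to [y] in the face of [- u] and, for each of
    these, along edges from [v] to [x] in the face of [u]. *)
Lemma cochain_face u v x w y : u != 0 ->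
  maximizes u v -> maximizes u x -> maximizes (- u) w -> maximizes (- u) y ->
  c v w - c x w = c v y - c x y.
Proof.
move=> u0 uv ux uw uy.
apply: (face_connected exposedW (u := - u)
  (S := fun y => c v w - c x w = c v y - c x y) _ uw uy) => // y1 y2 uy1 uy2 ey ->.
apply: (face_connected exposedW (u := u)
  (S := fun x => c v y1 - c x y1 = c v y2 - c x y2) _ uv ux); last by rewrite !subrr.
move=> x1 x2 ux1 ux2 ex.
have E1 := c_square u0 ux1 ux2 uy1 uy2 ex ey; move=> E2.
by rewrite -[LHS](subrKA (c x1 y1)) E1 E2 subrKA.
Qed.

(** [v] and [x] stay maximal from [u] to [u'], so [cochain_face] applies at each time while the
    opposite vertex moves from [w] to [y]. *)
Lemma cochain_difference u u' v x w y : u != 0 -> u' != 0 ->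
  maximizes u v -> maximizes u x -> maximizes (- u) w ->
  maximizes u' v -> maximizes u' x -> maximizes (- u') y ->
  c v w - c x w = c v y - c x y.
Proof.
move=> u0 u'0 uv ux uw u'v u'x u'y.
apply: (sweep_functional (W := W) (u := - u) (u' := - u') (v := w) (v' := y)
  (S := fun z => c v w - c x w = c v z - c x z)) => // t k l t01.
rewrite interpolateN => tk tl ->.
apply: (cochain_face (u := interpolate t u u')) => //.
- exact: (interpolate_neq0 fullW t01 u0 u'0 uv u'v).
- exact: maximizes_interpolate.
- exact: maximizes_interpolate.
Qed.

(** [p] marks the vertices already treated; only differences within a common proper face are
    prescribed. *)
Definition has_potential (p : pred 'rV[R]_3) (psi : 'rV[R]_3 -> K) := forall u v x w,
  u != 0 -> p v -> p x -> maximizes u v -> maximizes u x -> maximizes (- u) w ->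
  psi v - psi x = c v w - c x w.

(** Any vertex above [v] in a common proper face forces the value at [v];
    [maximizes_neighbour_sweep] shows that all of them force the same one. *)
Lemma potential_extend g v psi : v \in W ->
  (forall w, w \in W -> dot g w = dot g v -> w = v) ->
  has_potential (fun x => dot g v < dot g x) psi ->
  exists psi', has_potential (fun x => dot g v <= dot g x) psi'.
Proof.
move=> vW ginj pot.
have [k kE] : exists k, forall u x w, u != 0 -> dot g v < dot g x ->
    maximizes u v -> maximizes u x -> maximizes (- u) w ->
    k - psi x = c v w - c x w.
  (* If no vertex above [v] shares a proper face with it, the value is unconstrained and 0
     serves. *)
  have [[u1 [v1 [w1 [u10 gv1 [u1v u1v1 u1w1]]]]]|H] := pselect (exists u x w,
    [/\ u != 0, dot g v < dot g x & [/\ maximizes u v, maximizes u x & maximizes (- u) w]]);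
    last first.
    by exists 0 => u x w u0 gx uv ux uw; case: H; exists u, x, w.
  exists (psi v1 + (c v w1 - c v1 w1)) => u2 v2 w2 u20 gv2 u2v u2v2 u2w2.
  pose S x := forall u w, u != 0 -> maximizes u v -> maximizes u x ->
    maximizes (- u) w -> psi v1 + (c v w1 - c v1 w1) - psi x = c v w - c x w.
  suff : S v2 by apply; first exact: u20.
  apply: (maximizes_neighbour_sweep ginj u10 u20 u1v u1v1 u2v u2v2 gv1 gv2).
    move=> u x y u0 uv ux uy gx gy Sx u' w u'0 u'v u'y u'w.
    have [w' uw'] := exists_maximizes fullW (- u).
    rewrite (cochain_difference u'0 u0 u'v u'y u'w uv uy uw').
    have := Sx _ _ u0 uv ux uw'; have := pot _ _ _ _ u0 gx gy ux uy uw'.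
    move=> E1 E2; transitivity ((psi v1 + (c v w1 - c v1 w1) - psi x) + (psi x - psi y)).
      by ring.
    by rewrite E1 E2; ring.
  move=> u w u0 uv uv1 uw; rewrite addrAC subrr add0r.
  exact: (cochain_difference u10 u0 u1v u1v1 u1w1 uv uv1 uw).
exists (fun x => if x == v then k else psi x) => u x y w u0 gx gy ux uy uw.
have gt z : dot g v <= dot g z -> maximizes u z -> z != v -> dot g v < dot g z.
  move=> gz /maximizesP[zW _] zv; rewrite lt_neqAle gz andbT.
  by apply: contra zv => /eqP/esym/(ginj _ zW)->.
have [xv|xv] := eqVneq x v; have [yv|yv] := eqVneq y v.
- by rewrite xv yv !subrr.
- by rewrite xv in ux *; apply: (kE u) => //; exact: gt.
- rewrite yv in uy *; rewrite -opprB (kE u x w) ?opprB //; exact: gt.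
- by apply: (pot u) => //; exact: gt.
Qed.

(** A generic [g] orders the vertices strictly; they are added from the top down, [rank] counting
    those strictly above. *)
Lemma potential_exists : exists psi, has_potential predT psi.
Proof.
have [g gW] := generic_functional [seq x - y | x <- W, y <- W].
have ginj x y : x \in W -> y \in W -> dot g x = dot g y -> x = y.
  move=> xW yW E; apply/eqP; rewrite -subr_eq0; apply: contraT => xy.
  have /gW : x - y \in [seq x - y | x <- W, y <- W] by apply: allpairs_f.
  by rewrite xy dotDr dotNr E subrr eqxx => /(_ isT).
pose rank v := count (fun z => dot g v < dot g z) W.
suff /(_ (size W)) [psi pot] : forall n, exists psi,
    has_potential (fun v => (rank v < n)%N) psi.
  exists psi => u v x w u0 _ _ uv ux uw.
  have rk z : maximizes u z -> (rank z < size W)%N.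
    move=> /maximizesP[zW _]; rewrite -(count_predT W).
    by apply: (count_lt _ zW) => //=; rewrite ltxx.
  by apply: (pot u) => //; exact: rk.
have rank_lt x y : x \in W -> y \in W -> (rank x < rank y)%N = (dot g y < dot g x).
  have H z z' : z \in W -> dot g z' < dot g z -> (rank z < rank z')%N.
    move=> zW lt; apply: (count_lt _ zW) => //= [a /(lt_trans lt)//|].
    by rewrite ltxx.
  move=> xW yW; case: (ltrgtP (dot g y) (dot g x)) => [/(H _ _ xW)//|/(H _ _ yW)|].
    by move=> /ltnW; rewrite leqNgt => /negbTE.
  by move=> /(ginj _ _ yW xW)->; rewrite ltnn.
elim=> [|n [psi pot]]; first by exists (fun=> 0) => ? ? ? ?.
have [[v vW vn]|H] := pselect (exists2 v, v \in W & rank v = n); last first.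
  exists psi => u v x w u0 vn xn uv ux uw.
  have lt z : maximizes u z -> (rank z < n.+1)%N -> (rank z < n)%N.
    move=> /maximizesP[zW _]; rewrite ltnS leq_eqVlt => /orP[/eqP zn|//].
    by case: H; exists z.
  by apply: (pot u) => //; exact: lt.
have [||psi' pot'] := @potential_extend g v psi vW.
- by move=> w wW /ginj; apply.
- move=> u x y w u0 gx gy ux uy uw.
  have [[xW _] [yW _]] := (maximizesP _ _ _ ux, maximizesP _ _ _ uy).
  by apply: (pot u) => //; rewrite -vn rank_lt.
exists psi' => u x y w u0 rx ry ux uy uw.
have [[xW _] [yW _]] := (maximizesP _ _ _ ux, maximizesP _ _ _ uy).
by apply: (pot' u) => //; rewrite leNgt -rank_lt // -leqNgt vn -ltnS.
Qed.

(** Opposite maximizers are the pairs maximizing [dot u r.1 - dot u r.2], which is linear in [u], so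
    the sweep can run over pairs. *)
Lemma sweep_pair u u' (S : 'rV[R]_3 * 'rV[R]_3 -> Prop) p p' :
  (forall t r s, 0 <= t <= 1 ->
     maximizes (interpolate t u u') r.1 -> maximizes (- interpolate t u u') r.2 ->
     maximizes (interpolate t u u') s.1 -> maximizes (- interpolate t u u') s.2 ->
     S r -> S s) ->
  maximizes u p.1 -> maximizes (- u) p.2 ->
  maximizes u' p'.1 -> maximizes (- u') p'.2 -> S p -> S p'.
Proof.
move=> cl up1 up2 up1' up2'.
pose pairs := [seq (x, y) | x <- W, y <- W].
have pairsP (r : 'rV[R]_3 * 'rV[R]_3) : r \in pairs <-> r.1 \in W /\ r.2 \in W.
  split=> [/allpairsP[s [s1 s2 ->]] //|[r1 r2]].
  by rewrite [r]surjective_pairing; apply: allpairs_f.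
have W1 z x : maximizes z x -> x \in W by case/maximizesP.
have le (z : 'rV[R]_3) (r s : 'rV[R]_3 * 'rV[R]_3) : maximizes z r.1 -> maximizes (- z) r.2 ->
    s \in pairs -> dot z s.1 - dot z s.2 <= dot z r.1 - dot z r.2.
  move=> /maximizesP[_ m1] /maximizesP[_ m2] /pairsP[s1 s2].
  by have := m1 _ s1; have := m2 _ s2; rewrite !dotNl; lra.
apply: (sweep_interval (f := fun r => dot u r.1 - dot u r.2)
  (g := fun r => dot u' r.1 - dot u' r.2) (s := pairs) ler01).
- have mx t r : maximal_at (fun r => dot u r.1 - dot u r.2)
      (fun r => dot u' r.1 - dot u' r.2) pairs t r ->
      maximizes (interpolate t u u') r.1 /\ maximizes (- interpolate t u u') r.2.
    move=> [/pairsP[r1 r2] rm]; split; apply/maximizesP; split=> // w wW.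
      have /rm /= : (w, r.2) \in pairs by apply/pairsP.
      by rewrite !dot_interpolate; lra.
    have /rm /= : (r.1, w) \in pairs by apply/pairsP.
    by rewrite !dotNl !dot_interpolate; lra.
  by move=> t k l t01 /mx[k1 k2] /mx[l1 l2]; exact: (cl t).
- by apply: maximal_at0 => [|s]; [apply/pairsP; split; [exact: W1 up1|exact: W1 up2]|exact: le].
- by apply: maximal_at1 => [|s]; [apply/pairsP; split; [exact: W1 up1'|exact: W1 up2']|exact: le].
Qed.

Lemma cochain_is_coboundary : exists psi, forall u v w, u != 0 ->
  maximizes u v -> maximizes (- u) w -> c v w = psi v - psi w.
Proof.
have [psi pot] := potential_exists; exists psi.
pose kappa v w := c v w - (psi v - psi w).
have kappa_face u v w x y : u != 0 -> maximizes u v -> maximizes (- u) w ->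
    maximizes u x -> maximizes (- u) y -> kappa v w = kappa x y.
  move=> u0 uv uw ux uy; have nu0 : - u != 0 by rewrite oppr_eq0.
  transitivity (kappa x w).
    apply/eqP; rewrite -subr_eq0; apply/eqP.
    have := pot _ _ _ _ u0 isT isT uv ux uw; rewrite /kappa => E.
    by transitivity (c v w - c x w - (psi v - psi x)); [ring|rewrite E subrr].
  have ux' : maximizes (- - u) x by rewrite opprK.
  have := pot _ _ _ _ nu0 isT isT uw uy ux'.
  rewrite (c_anti u0 ux uw) (c_anti u0 ux uy) /kappa => E.
  apply/eqP; rewrite -subr_eq0; apply/eqP.
  transitivity (psi w - psi y - (- c x w - - c x y)); first by ring.
  by rewrite E subrr.
(* Orthogonality keeps the segment from [u] to [q] away from 0, so [kappa_face] applies
   throughout. *)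
have kappa_orth u q v w x y : u != 0 -> q != 0 -> dot q u = 0 ->
    maximizes u v -> maximizes (- u) w -> maximizes q x -> maximizes (- q) y ->
    kappa v w = kappa x y.
  move=> u0 q0 qu uv uw qx qy.
  apply: (sweep_pair (u := u) (u' := q) (p := (v, w)) (p' := (x, y))
    (S := fun p => kappa v w = kappa p.1 p.2)) => // t r s t01 r1 r2 s1 s2 ->.
  apply: (kappa_face (interpolate t u q)) => //.
  apply/negP => /eqP E; have := dot0l u; have := dot0l q.
  rewrite -E !dot_interpolate qu (dotC u q) qu !mulr0 addr0 add0r => /eqP.
  rewrite mulf_eq0 (gt_eqF (dot_gt0 q0)) orbF => /eqP ->.
  rewrite subr0 mul1r => uu; have := dot_gt0 u0.
  by rewrite uu ltxx.
move=> u v w u0 uv uw.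
(* Going from [u] to [- u] through an orthogonal [q] avoids 0 and gives [kappa v w = kappa w v]. *)
have [q [q0 qu _]] := orthogonal2 u u.
have [x qx] := exists_maximizes fullW q; have [y qy] := exists_maximizes fullW (- q).
have : kappa v w = kappa w v.
  rewrite (kappa_orth u q v w x y) // (kappa_orth (- u) q w v x y) ?oppr_eq0 ?opprK //.
  by rewrite dotNr qu oppr0.
rewrite /kappa (c_anti u0 uv uw) => E.
have : (c v w - (psi v - psi w)) *+ 2 = 0.
  by rewrite mulr2n {1}E; ring.
by move/eqP; rewrite mulrn_eq0 /= subr_eq0 => /eqP.
Qed.

End Cochain.

(** * Connectedness of the antipodal graph *)

Section Connected.
Variables (R : realType) (W : seq 'rV[R]_3).
Hypothesis exposedW : forall v, v \in W ->
  exists a, forall w, w \in W -> w != v -> dot a w < dot a v.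
Hypothesis fullW : forall u c, (forall w, w \in W -> dot u w = c) -> u = 0.

(** In the sweep from a functional exposing [v] to one exposing [w], all vertices of a face are
    antipodal to a common vertex, hence share its value. *)
Lemma antipodal_connected (T : Type) (psi : 'rV[R]_3 -> T) :
  (forall u v w, u != 0 -> maximizes W u v -> maximizes W (- u) w -> psi v = psi w) ->
  {in W &, forall v w, psi v = psi w}.
Proof.
move=> H v w vW wW.
have [->//|vw] := eqVneq v w.
have [a av] := exposedW vW; have [b bw] := exposedW wW.
have wv : w != v by rewrite eq_sym.
have am : maximizes W a v.
  apply/maximizesP; split=> // z zW; have [->//|zv] := eqVneq z v.
  exact/ltW/av.
have bm : maximizes W b w.
  apply/maximizesP; split=> // z zW; have [->//|zw] := eqVneq z w.
  exact/ltW/bw.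
have a0 : a != 0.
  by apply/eqP => a0; have := av _ wW wv; rewrite a0 !dot0l ltxx.
have b0 : b != 0.
  by apply/eqP => b0; have := bw _ vW vw; rewrite b0 !dot0l ltxx.
(* If the segment meets 0, [a] is a nonpositive multiple of [b], so [w] minimizes [a] and is
   antipodal to [v]. *)
have [[t [t01 ab]]|nab] :=
  pselect (exists t, 0 <= t <= 1 /\ interpolate t a b = 0).
  apply: (H a) => //; apply/maximizesP; split=> // z zW; rewrite !dotNl.
  case/andP: t01 => t0 t1.
  have D x : (1 - t) * dot a x + t * dot b x = 0.
    by rewrite -dot_interpolate ab dot0l.
  have [tE|tn] := eqVneq t 1.
    have := D w; have := D v; have := bw _ vW vw; rewrite tE; lra.
  have t1' : 0 < 1 - t by rewrite subr_gt0 lt_neqAle tn.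
  rewrite lerN2 -(ler_pM2l t1').
  have := D w; have := D z; case/maximizesP: bm => _ /(_ _ zW).
  move=> ? ? ?; nra.
apply: (sweep_functional (W := W) (u := a) (u' := b) (v := v) (v' := w)
  (S := fun x => psi v = psi x)) => // t x y t01 tx ty ->.
have [z tz] := exists_maximizes fullW (- interpolate t a b).
have i0 : interpolate t a b != 0.
  by apply/eqP => E; apply: nab; exists t.
by rewrite (H _ _ _ i0 tx tz) (H _ _ _ i0 ty tz).
Qed.

End Connected.

(** * Vertices and edges of a convex polyhedron *)

Section Hull.
Variables (R : realType) (n : nat) (p : 'I_n -> 'rV[R]_3).
Implicit Types u v w x y z : 'rV[R]_3.
Local Notation P := (conv_hull p).

Lemma conv_hull_le u M x : (forall i, dot u (p i) <= M) -> P x -> dot u x <= M.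
Proof.
move=> pM [a [a0 a1 ->]]; rewrite dot_sumr -[leRHS]mul1r -a1 mulr_suml.
by apply: ler_sum => i _; apply: ler_wpM2l.
Qed.

Lemma conv_hull_segment v w : P v -> P w -> segment v w `<=` P.
Proof.
move=> [a [a0 a1 ->]] [b [b0 b1 ->]] _ [t /andP[t0 t1] ->].
exists (fun i => (1 - t) * a i + t * b i); split=> [i||].
- by have := a0 i; have := b0 i; nra.
- by rewrite big_split -!mulr_sumr /= a1 b1; ring.
- rewrite !scaler_sumr -big_split; apply: eq_bigr => i _.
  by rewrite /= !scalerA -scalerDl.
Qed.

Lemma is_vertex_generator u i : (forall j, dot u (p j) <= dot u (p i)) ->
  (forall j, dot u (p j) = dot u (p i) -> p j = p i) -> is_vertex P (p i).
Proof.
move=> um uq; split; first by exists (p i).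
exists u; apply/seteqP; split=> x /= => [->|[[a [a0 a1 xE]] xm]].
  by split=> [|y]; [exact: conv_hull_gen|exact: conv_hull_le].
rewrite xE -[RHS]scale1r -a1 scaler_suml.
apply: eq_bigr => j _; have [->|aj] := eqVneq (a j) 0; first by rewrite !scale0r.
congr (_ *: _); apply/uq/(@conv_hull_max _ n p u _ a) => //.
by rewrite -xE; apply/xm/conv_hull_gen.
Qed.

(* Among the generators maximizing [u], one farthest from the origin is exposed
   by an infinitesimal perturbation of [u] in its own direction. *)
Lemma exists_vertex_max u (i0 : 'I_n) :
  exists2 i, is_vertex P (p i) & forall j, dot u (p j) <= dot u (p i).
Proof.
have [m _ mm] := @exists_max _ _ (enum 'I_n) (fun i => dot u (p i)) i0 (mem_enum _ _).
have {}mm j : dot u (p j) <= dot u (p m) by apply: mm; rewrite mem_enum.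
pose s := [seq i <- enum 'I_n | dot u (p i) == dot u (p m)].
have sE i : (i \in s) = (dot u (p i) == dot u (p m)).
  by rewrite mem_filter mem_enum andbT.
have ms : m \in s by rewrite sE.
have [i si im] := exists_max (fun i => dot (p i) (p i)) ms.
have ui : dot u (p i) = dot u (p m) by apply/eqP; rewrite -sE.
exists i; last by rewrite ui.
have [eps e0 es] := small_eps (fun j => dot (p i) (p j) - dot (p i) (p i))
  (fun j => dot u (p m) - dot u (p j)).
have lt j : p j != p i -> dot (u + eps *: p i) (p j) < dot (u + eps *: p i) (p i).
  move=> ji; rewrite !dotDl !dotZl ui.
  have [uj|uj] := eqVneq (dot u (p j)) (dot u (p m)).
    rewrite uj ltrD2l ltr_pM2l //.
    (* As [p j] is no longer than [p i], expanding this square gives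
       [dot (p i) (p j) < dot (p i) (p i)]. *)
    have d0 : 0 < dot (p j - p i) (p j - p i) by rewrite dot_gt0 // subr_eq0.
    have sj : j \in s by rewrite sE uj.
    have := im _ sj; move: d0; rewrite !dotDl !dotDr !dotNl !dotNr.
    by rewrite (dotC (p j) (p i)); lra.
  have := es j; rewrite subr_gt0 lt_neqAle uj mm => /(_ isT); lra.
apply: (@is_vertex_generator (u + eps *: p i)) => j.
  by have [->//|/lt/ltW] := eqVneq (p j) (p i).
by move=> E; apply/eqP; apply: contraT => /lt; rewrite E ltxx.
Qed.

(** For small [eps], a vertex maximizing [u + eps *: b] still maximizes [u], so it is [v] or [w]. *)
Lemma face_le u v w b i : (forall j, dot u (p j) <= dot u (p i)) ->
  (forall j, is_vertex P (p j) -> dot u (p j) = dot u (p i) ->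
     p j = v \/ p j = w) ->
  dot b (p i) <= dot b v \/ dot b (p i) <= dot b w.
Proof.
move=> um uq.
have [eps e0 es] := small_eps (fun j => dot b (p j) - dot b (p i))
  (fun j => dot u (p i) - dot u (p j)).
have [j jv /(_ i) jm] := exists_vertex_max (u + eps *: b) i.
have uj : dot u (p j) = dot u (p i).
  apply/le_anti; rewrite um /= leNgt; apply/negP => lt.
  have := es j; rewrite subr_gt0 => /(_ lt).
  by move: jm; rewrite !dotDl !dotZl; lra.
move: jm; rewrite !dotDl !dotZl uj lerD2l ler_pM2l // => le.
by case: (uq j jv uj) le => ->; [left|right].
Qed.

(** [t] comes from projecting [y - v] onto [d]. Testing [face_le] on the orthogonal rest [r] gives
    [r = 0]; testing it on [- d] and [d] bounds [t]. *)
Lemma face_generator_segment u v w i : v != w ->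
  (forall j, dot u (p j) <= dot u (p i)) ->
  (forall j, is_vertex P (p j) -> dot u (p j) = dot u (p i) ->
     p j = v \/ p j = w) ->
  exists2 t, 0 <= t <= 1 & p i = v + t *: (w - v).
Proof.
move=> vw um uq; set y := p i.
have [d dE] : exists d, d = w - v by exists (w - v).
rewrite -dE; have d0 : 0 < dot d d by rewrite dot_gt0 // dE subr_eq0 eq_sym.
have le b := face_le b um uq.
pose t := dot d (y - v) / dot d d.
have tE : t * dot d d = dot d (y - v) by rewrite divfK // gt_eqF.
pose r := y - v - t *: d.
have rd : dot r d = 0 by rewrite dotC /r dotDr dotNr dotZr tE subrr.
have r0 : r = 0.
  apply/eqP; apply: contraT => /dot_gt0.
  have rE : dot r w = dot r v by apply/eqP; rewrite -subr_eq0 -dotNr -dotDr -dE rd.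
  have ry : dot r y <= dot r v by have := le r; rewrite rE => -[].
  have -> : dot r r = dot r (y - v) by rewrite {2}/r dotDr dotNr dotZr rd mulr0 subr0.
  by rewrite dotDr dotNr subr_gt0 => /lt_le_trans/(_ ry); rewrite ltxx.
have yE : y = v + t *: d by apply/eqP; rewrite -subr_eq0 opprD addrA -/r r0.
have wE : dot d w = dot d v + dot d d by rewrite -dotDr {3}dE addrC subrK.
exists t => //; apply/andP; split.
- rewrite -(pmulr_lge0 _ d0); have := le (- d).
  by rewrite -/y yE !dotNl wE !dotDr !dotZr => -[]; lra.
- rewrite -(ler_pM2r d0); have := le d.
  by rewrite -/y yE wE !dotDr !dotZr => -[]; lra.
Qed.

End Hull.

Section Polyhedron.
Local Open Scope fset_scope.
Local Open Scope ring_scope.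
Variables (R : realType) (P : set 'rV[R]_3).
Hypothesis hP : convex_polyhedron P.
Implicit Types u v w x y z : 'rV[R]_3.

Local Notation W := (enum_fset (vertices P)).

Lemma mem_vertices v : v \in W <-> is_vertex P v.
Proof.
rewrite -[v \in W]/(v \in vertices P) (in_fset_set (finite_vertices hP)).
by rewrite inE; split=> // /asboolP.
Qed.

Lemma vertex_sub v : v \in W -> P v.
Proof. by move=> /mem_vertices/face_sub; apply. Qed.

Lemma polyhedron_vertex_max u : exists2 v, v \in W & forall z, P z -> dot u z <= dot u v.
Proof.
case: (hP) => [[n [p PE]] [x /interior_subset Px]].
have [a [_ a1 _]] : conv_hull p x by rewrite -PE.
case: n p a PE a1 => [|n] p a PE a1.
  by move: a1; rewrite big_ord0 => /eqP; rewrite eq_sym oner_eq0.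
have [i iv im] := exists_vertex_max p u ord0.
exists (p i); first by apply/mem_vertices; rewrite PE.
by move=> z; rewrite PE; exact: conv_hull_le.
Qed.

Lemma vertices_exposed v : v \in W ->
  exists a, forall w, w \in W -> w != v -> dot a w < dot a v.
Proof.
move=> vW; have [_ [u E]] := (mem_vertices v).1 vW.
exists u => w wW; apply: contraNT; rewrite -leNgt => le; apply/eqP.
suff : [set v] w by [].
have [_ vm] : P v /\ forall y, P y -> dot u y <= dot u v.
  by have : [set v] v by []; rewrite {1}E.
by rewrite E; split=> [|y /vm /le_trans]; [exact: vertex_sub|apply].
Qed.

Lemma vertices_full u c : (forall w, w \in W -> dot u w = c) -> u = 0.
Proof.
move=> uc; apply/eqP; apply: contraT => u0.
exfalso; apply: (full_dim (c := c) hP.2 u0) => z Pz.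
have [v vW /(_ _ Pz)] := polyhedron_vertex_max u.
have [w wW /(_ _ Pz)] := polyhedron_vertex_max (- u).
by rewrite !dotNl (uc _ vW) (uc _ wW); lra.
Qed.

Lemma maximizes_polyhedron u v :
  maximizes W u v <-> v \in W /\ forall z, P z -> dot u z <= dot u v.
Proof.
split=> [/maximizesP[vW vm]|[vW vm]].
  split=> // z Pz; have [w wW wm] := polyhedron_vertex_max u.
  by apply: (le_trans (wm _ Pz)); exact: vm.
by apply/maximizesP; split=> // w /vertex_sub/vm.
Qed.

Lemma antipodal_verticesP v w : v \in W -> w \in W ->
  antipodal P v w <-> exists u, [/\ u != 0, maximizes W u v & maximizes W (- u) w].
Proof.
move=> vW wW; split=> [[_ _ [u u0 H]]|[u [u0 uv uw]]].
  exists u; split=> //; apply/maximizes_polyhedron; split=> // z /H /andP[] //.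
  by rewrite !dotNl lerN2.
split; [exact: vertex_sub|exact: vertex_sub|exists u => // z Pz].
move/maximizes_polyhedron: uv => [_ /(_ _ Pz) ->].
by move/maximizes_polyhedron: uw => [_ /(_ _ Pz)]; rewrite !dotNl lerN2 => ->.
Qed.

(** The generators with nonzero weight in a point of the face lie on the face themselves, hence on
    the segment by [face_generator_segment]. *)
Lemma edge_polyhedron v w : abstract_edge W v w -> is_edge P [fset v; w].
Proof.
move=> [[vw vW wW] [u uE]]; exists v, w; split=> //; split.
  by exists v; exact: seg_l.
have um : maximizes W u v by rewrite uE // eqxx.
have uw : maximizes W u w by rewrite uE // eqxx orbT.
have E := maximizes_eq um uw.
have [_ vm] := (maximizes_polyhedron u v).1 um.
exists u; apply/seteqP; split=> x /=.
  move=> sx; have ux : dot u x = dot u v.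
    by case: sx => t _ ->; rewrite dotDr !dotZr -E; ring.
  split; last by rewrite ux.
  case: (hP) => [[n [p PE]] _]; rewrite PE.
  by apply: conv_hull_segment sx; rewrite -PE; exact: vertex_sub.
move=> [Px xm]; have ux : dot u x = dot u v.
  by apply/le_anti; rewrite vm //= xm //; exact: vertex_sub.
case: (hP) => [[n [p PE]] _]; move: (Px); rewrite PE => -[a [a0 a1 xE]].
have gen i : a i != 0 -> exists2 t, 0 <= t <= 1 & p i = v + t *: (w - v).
  move=> ai; have pv : dot u (p i) = dot u v.
    apply: (@conv_hull_max _ n p u (dot u v) a) => // [j|].
      by apply: vm; rewrite PE; exact: conv_hull_gen.
    by rewrite -xE ux.
  apply: (@face_generator_segment _ n p u) => // j.
    by rewrite pv; apply: vm; rewrite PE; exact: conv_hull_gen.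
  rewrite -PE => /mem_vertices jW uj.
  have : maximizes W u (p j).
    by apply/maximizes_polyhedron; split=> // z; rewrite uj pv; exact: vm.
  by rewrite uE // => /orP[]/eqP; [left|right].
(* For weight 0 the parameter is arbitrary, since it enters only through [a i * t i]. *)
have [t tE] : exists t : 'I_n -> R, forall i, a i != 0 ->
    0 <= t i <= 1 /\ p i = v + t i *: (w - v).
  have H i : exists ti : R, a i != 0 -> 0 <= ti <= 1 /\ p i = v + ti *: (w - v).
    by have [_|/gen[ti t01 ->]] := eqVneq (a i) 0; [exists 0|exists ti].
  by exists (fun i => projT1 (cid (H i))) => i; exact: projT2 (cid (H i)).
have term i : 0 <= a i * t i <= a i.
  have [->|/tE[/andP[ti0 ti1] _]] := eqVneq (a i) 0; first by rewrite mul0r lexx.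
  by rewrite mulr_ge0 //= ler_piMr.
exists (\sum_i a i * t i).
  rewrite sumr_ge0 => [|i _]; last by case/andP: (term i).
  by rewrite -a1 ler_sum // => i _; case/andP: (term i).
have -> : (1 - \sum_i a i * t i) *: v + (\sum_i a i * t i) *: w =
    v + (\sum_i a i * t i) *: (w - v).
  by rewrite scalerBl scale1r scalerBr addrAC addrA.
rewrite xE -[X in _ = X + _]scale1r -{1}a1 !scaler_suml -big_split.
apply: eq_bigr => i _ /=; have [->|/tE[_ {1}->]] := eqVneq (a i) 0.
  by rewrite mul0r !scale0r addr0.
by rewrite scalerDr scalerA.
Qed.

End Polyhedron.

(** * Boundary ranks of a two-dimensional complex *)

Section Incidence.
Local Open Scope fset_scope.
Local Open Scope ring_scope.
Variable T : choiceType.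
Implicit Types (a b : T) (p : {fset T}).

Lemma step_incidence_rev p a b : a != b ->
  step_incidence p b a = - step_incidence p a b.
Proof.
move=> ab; rewrite /step_incidence fsetUC; case: eqP => [<-|]; last by rewrite oppr0.
have ba : b != a by rewrite eq_sym.
by case: (fset2_enum ab) => ->; rewrite /= !eqxx ?(negbTE ab) ?(negbTE ba) ?opprK.
Qed.

Lemma step_incidence_neq0 a b : step_incidence [fset a; b] a b != 0.
Proof. by rewrite /step_incidence eqxx; case: ifP; rewrite ?oppr_eq0 oner_eq0. Qed.

End Incidence.

Section ExactComplex.
Local Open Scope fset_scope.
Local Open Scope ring_scope.
Variables (T : choiceType) (X : complex2 T).
Hypothesis wfX : complex2_wf X.
Implicit Types (a b : T) (c : 'cV[rat]_#|cells X 1|).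

(** Reads a column as a function of ordered pairs, signed by orientation and 0 off the 1-cells. *)
Definition cochain_value c a b : rat :=
  \sum_(p : cells X 1) step_incidence (val p) a b * c (enum_rank p) 0.

Lemma cochain_value_rev c a b : a != b -> cochain_value c b a = - cochain_value c a b.
Proof.
move=> ab; rewrite /cochain_value -sumrN; apply: eq_bigr => p _.
by rewrite step_incidence_rev // mulNr.
Qed.

Lemma cochain_value_cell c a b (abX : [fset a; b] \in cells1 X) :
  cochain_value c a b =
    step_incidence [fset a; b] a b * c (enum_rank ([` abX] : cells X 1)%fset) 0.
Proof.
rewrite /cochain_value (bigD1 [` abX]%fset) //= big1 ?addr0 // => p pn.
rewrite /step_incidence ifN ?mul0r //.
by apply: contra pn => /eqP e; apply/eqP/val_inj.
Qed.

Lemma boundary1_mul c (s : cells X 2) :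
  (boundary X 1 *m c) (enum_rank s) 0 =
  \sum_(ab <- zip (attach s) (rot 1 (attach s))) cochain_value c ab.1 ab.2.
Proof.
rewrite mxE (reindex (@enum_rank (cells X 1))) /=; last first.
  by apply: onW_bij; exact: enum_rank_bij.
under eq_bigr do rewrite mxE /= !enum_rankK /walk_incidence mulr_suml.
by rewrite exchange_big.
Qed.

(** Boundaries act on rows, so acting on columns they are coboundaries; the factor [step_incidence]
    undoes the chosen orientation. *)
Lemma boundary0_mul (y : T -> rat) a b (abX : [fset a; b] \in cells1 X) :
  step_incidence [fset a; b] a b *
  (boundary X 0 *m \col_j y (val (enum_val j)))
    (enum_rank ([` abX] : cells X 1)%fset) 0 = y b - y a.
Proof.
have [v [w [vw E vX wX]]] := wfX.1 _ abX.
have ab : a != b.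
  move: E => /(congr1 (fun A : {fset T} => #|` A|)); rewrite !cardfs2 vw.
  by case: eqP.
have mem x : x \in [fset a; b]%fset -> x \in cells0 X.
  by rewrite E !inE => /orP[]/eqP->.
have aX : a \in cells0 X by apply: mem; rewrite !inE eqxx.
have bX : b \in cells0 X by apply: mem; rewrite !inE eqxx orbT.
rewrite mxE mulr_sumr (reindex (@enum_rank (cells X 0))) /=; last first.
  by apply: onW_bij; exact: enum_rank_bij.
under eq_bigr do rewrite !mxE /= !enum_rankK mulrA step_vertex_incidence //= mulrBl.
rewrite sumrB; congr (_ - _).
- rewrite (bigD1 [` bX]%fset) //= eqxx mul1r big1 ?addr0 // => x xb.
  rewrite (_ : (b == val x) = false) ?mul0r //; apply: contraNF xb => /eqP bx.
  exact/eqP/val_inj.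
- rewrite (bigD1 [` aX]%fset) //= eqxx mul1r big1 ?addr0 // => x xa.
  rewrite (_ : (a == val x) = false) ?mul0r //; apply: contraNF xa => /eqP ax.
  exact/eqP/val_inj.
Qed.

Lemma coboundaryP c (y : T -> rat) :
  (forall a b, [fset a; b] \in cells1 X -> cochain_value c a b = y b - y a) ->
  c = boundary X 0 *m \col_j y (val (enum_val j)).
Proof.
move=> cE; apply/matrixP => i j; rewrite (ord1 j) -(enum_valK i).
case: (enum_val i : cells X 1) => p pX.
have [a [b [ab pE _ _]]] := wfX.1 _ pX; subst p.
apply: (mulfI (step_incidence_neq0 a b)).
rewrite -cochain_value_cell cE //.
exact/esym/boundary0_mul.
Qed.

(** There are no 3-cells, so second homology is the kernel of [boundary X 1]. *)
Lemma betti2E : betti X 2 = (#|cells2 X| - \rank (boundary X 1))%N.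
Proof.
rewrite /betti -mxrank_ker -(mxrank_cap_compl (cycle_space X 2) (boundary X 2)).
suff -> : (cycle_space X 2 :&: boundary X 2)%MS = 0 by rewrite mxrank0.
apply/eqP; rewrite -mxrank_eq0 -leqn0.
rewrite (leq_trans (mxrankS (capmxSr _ _))) // (leq_trans (rank_leq_row _)) //.
by rewrite /= card_void.
Qed.

(** The columns of the cokernel of [boundary X 1] are cocycles, hence coboundaries, so the cokernel
    factors through [boundary X 0]; this bounds its rank. The other inequality is
    [boundary_boundary]. *)
Lemma rank_boundary1 : (forall c, boundary X 1 *m c = 0 ->
    exists y : T -> rat, forall a b, [fset a; b] \in cells1 X ->
      cochain_value c a b = y b - y a) ->
  (\rank (boundary X 1) + \rank (boundary X 0) = #|cells X 1|)%N.
Proof.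
move=> exactX; apply/eqP; rewrite eqn_leq mulmx0_rank_max ?boundary_boundary //=.
rewrite -leq_subLR -mxrank_coker.
have H j : exists y, col j (cokermx (boundary X 1)) = boundary X 0 *m y.
  have [|y /coboundaryP ->] := exactX (col j (cokermx (boundary X 1))).
    by rewrite colE mulmxA mulmx_coker mul0mx.
  by eexists.
pose Y := \matrix_(i, j) (projT1 (cid (H j))) i 0.
have -> : cokermx (boundary X 1) = boundary X 0 *m Y.
  apply/matrixP => i j; have := projT2 (cid (H j)) => /matrixP/(_ i 0).
  rewrite mxE => ->; rewrite !mxE; apply: eq_bigr => k _; by rewrite [Y _ _]mxE.
exact: mxrankM_maxl.
Qed.

(** The 0-cocycles are the constants: the all-ones column bounds the rank above, and a cokernel with
    constant columns bounds it below. *)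
Lemma rank_boundary0 : (0 < #|` cells0 X|)%N ->
  (forall y : T -> rat, (forall a b, [fset a; b] \in cells1 X -> y a = y b) ->
     {in cells0 X &, forall a b, y a = y b}) ->
  (\rank (boundary X 0) + 1 = #|` cells0 X|)%N.
Proof.
move=> X0 conn; rewrite cardfE in X0 *.
have b0 (y : T -> rat) : boundary X 0 *m \col_j y (val (enum_val j)) = 0 <->
    forall a b, [fset a; b] \in cells1 X -> y a = y b.
  split=> [E a b abX|E].
    by apply/esym/eqP; rewrite -subr_eq0 -(boundary0_mul y abX) E mxE mulr0.
  apply/esym/coboundaryP => a b /E ->; rewrite subrr.
  by rewrite /cochain_value big1 // => p _; rewrite mxE mulr0.
apply/eqP; rewrite eqn_leq; apply/andP; split.
  have rank1 : \rank (\col_(j < #|cells X 0|) (1 : rat)) = 1%N.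
    apply/eqP; rewrite eqn_leq rank_leq_col lt0n mxrank_eq0.
    apply/eqP => /matrixP/(_ (Ordinal X0) 0); rewrite !mxE => /eqP.
    by rewrite oner_eq0.
  rewrite -[X in (_ + X <= _)%N]rank1.
  by apply: mulmx0_rank_max; apply/(b0 (fun=> 1)).
rewrite -leq_subLR -mxrank_coker.
have := mulmx_coker (boundary X 0); move: (cokermx _) => C bC.
have -> : C = (\col_(j < #|cells X 0|) (1 : rat)) *m row (Ordinal X0) C.
  apply/matrixP => i j; rewrite !mxE big_ord1 !mxE mul1r.
  pose y t := if insub t is Some x then C (enum_rank (x : cells X 0)) j else 0.
  have yE (x : cells X 0) : y (val x) = C (enum_rank x) j.
    by rewrite /y valK.
  have Cj : col j C = \col_k y (val (enum_val k)).
    by apply/matrixP => k l; rewrite !mxE yE enum_valK.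
  move/(congr1 (col j)): bC; rewrite col0 colE -mulmxA -colE Cj => /b0/conn H.
  rewrite -[i]enum_valK -[Ordinal _]enum_valK -!yE.
  by apply: H; exact: valP.
by apply: leq_trans (mxrankM_maxl _ _) _; exact: rank_leq_col.
Qed.

End ExactComplex.

(** * Homology of the antipodal square complex *)

Section SquareComplexHomology.
Local Open Scope fset_scope.
Local Open Scope ring_scope.
Variables (R : realType) (P : set 'rV[R]_3).
Hypothesis hP : convex_polyhedron P.
Implicit Types u v w x y z : 'rV[R]_3.

Local Notation W := (enum_fset (vertices P)).
Local Notation X := (square_complex P).

Lemma square_complex_cell1 u v w : u != 0 -> maximizes W u v ->
  maximizes W (- u) w -> v != w /\ [fset v; w] \in cells1 X.
Proof.
move=> u0 uv uw; have [[vW _] [wW _]] := (maximizesP _ _ _ uv, maximizesP _ _ _ uw).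
have vw : v != w.
  apply: contraNneq u0 => vw; rewrite -vw in uw.
  apply/eqP/(vertices_full hP (c := dot u v)) => z zW.
  case/maximizesP: uv => _ /(_ _ zW); case/maximizesP: uw => _ /(_ _ zW).
  by rewrite !dotNl; lra.
split=> //; rewrite /= (in_fset_set (finite_antipodal_vertex_pairs hP)) inE.
exists v, w; split=> //; try exact/(mem_vertices hP).
by apply/(antipodal_verticesP hP) => //; exists u.
Qed.

Lemma square_complex_cell1_inv a b : [fset a; b] \in cells1 X ->
  exists u, [/\ u != 0, maximizes W u a & maximizes W (- u) b].
Proof.
rewrite /= (in_fset_set (finite_antipodal_vertex_pairs hP)) inE.
move=> [v [w [vw E /(mem_vertices hP) vW /(mem_vertices hP) wW]]].
move=> /(antipodal_verticesP hP vW wW)[u [u0 uv uw]].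
have : a \in [fset v; w] by rewrite -E !inE eqxx.
have : b \in [fset v; w] by rewrite -E !inE eqxx orbT.
have ab : a != b.
  move: E => /(congr1 (fun A : {fset _} => #|` A|)); rewrite !cardfs2 vw.
  by case: eqP.
rewrite !inE => /orP[]/eqP bE /orP[]/eqP aE; subst; rewrite ?eqxx // in ab.
  by exists (- u); rewrite oppr_eq0 opprK.
by exists u.
Qed.

Lemma midpoint_maximal u v x : v != x -> maximizes W u v -> maximizes W u x ->
  forall z, P z -> dot u z <= dot u (midpoint [fset v; x]).
Proof.
move=> vx uv ux z Pz; rewrite midpoint2 // dotZr dotDr (maximizes_eq uv ux).
have [_ /(_ _ Pz)] := (maximizes_polyhedron hP u x).1 ux; lra.
Qed.

Lemma midpoint_polyhedron v x : v != x -> v \in W -> x \in W ->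
  P (midpoint [fset v; x]).
Proof.
move=> vx vW xW; case: (hP) => [[n [p PE]] _]; rewrite PE.
apply: (@conv_hull_segment _ n p v x); rewrite -?PE; try exact: (vertex_sub hP).
exists 2^-1; first by lra.
by rewrite midpoint2 // scalerDr; congr (_ *: _ + _); lra.
Qed.

Lemma square_relation c : boundary X 1 *m c = 0 ->
  forall u v x w y, u != 0 -> maximizes W u v -> maximizes W u x ->
  maximizes W (- u) w -> maximizes W (- u) y ->
  abstract_edge W v x -> abstract_edge W w y ->
  cochain_value c v w - cochain_value c x w =
  cochain_value c v y - cochain_value c x y.
Proof.
move=> bc u v x w y u0 uv ux uw uy evx ewy.
have [[[vx vW xW] _] [[wy wW yW] _]] := (evx, ewy).
have [[vw _] [vy _]] := (square_complex_cell1 u0 uv uw, square_complex_cell1 u0 uv uy).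
have [[xw _] [xy _]] := (square_complex_cell1 u0 ux uw, square_complex_cell1 u0 ux uy).
have ef : [fset v; x] != [fset w; y].
  apply/eqP => /fsetP/(_ v); rewrite !inE eqxx /= => /esym/orP[]/eqP E.
    by rewrite E eqxx in vw.
  by rewrite E eqxx in vy.
have sX : [fset [fset v; x]; [fset w; y]] \in antipodal_edge_pairs P.
  rewrite (in_fset_set (finite_antipodal_edge_pairs hP)) inE.
  exists [fset v; x], [fset w; y]; split=> //; try exact: (edge_polyhedron hP).
  split; [exact: midpoint_polyhedron|exact: midpoint_polyhedron|].
  exists u => // z Pz; rewrite (midpoint_maximal vx uv ux Pz) andbT.
  by have := midpoint_maximal wy uw uy Pz; rewrite !dotNl lerN2.
have := boundary1_mul c ([` sX] : cells X 2).
rewrite bc mxE /= /square_walk /=.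
have rev := cochain_value_rev c.
(* Each two-element set may be enumerated in either order; all eight walks give the same relation up
   to sign. *)
case: (fset2_enum ef) => ->; case: (fset2_enum vx) => ->; case: (fset2_enum wy) => ->;
  rewrite /= !big_cons big_nil /= ?(rev _ _ vw) ?(rev _ _ vy) ?(rev _ _ xw) ?(rev _ _ xy);
  move: (cochain_value c v w) (cochain_value c v y) (cochain_value c x w)
    (cochain_value c x y) => *; lra.
Qed.

Lemma square_complex_rank :
  (\rank (boundary X 1) + nV P = nA P + 1)%N.
Proof.
have wf := square_complex_wf hP.
have exW := vertices_exposed hP; have fW := vertices_full hP.
have r1 : (\rank (boundary X 1) + \rank (boundary X 0) = #|cells X 1|)%N.
  apply: rank_boundary1 => // c bc.
  have [|psi psiE] := cochain_is_coboundary exW fW _ (square_relation bc).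
    move=> u v w u0 uv uw; apply: cochain_value_rev.
    by case: (square_complex_cell1 u0 uv uw).
  (* The sign converts [psi a - psi b] to the convention [y b - y a]. *)
  exists (fun x => - psi x) => a b /square_complex_cell1_inv[u [u0 ua ub]].
  by rewrite (psiE _ _ _ u0 ua ub) opprK addrC.
have r0 : (\rank (boundary X 0) + 1 = nV P)%N.
  apply: rank_boundary0 => // [|y yE].
    have [v vW _] := polyhedron_vertex_max hP 0.
    by rewrite cardfs_gt0; apply/fset0Pn; exists v.
  apply: (antipodal_connected exW fW) => u v w u0 uv uw.
  by apply: yE; case: (square_complex_cell1 u0 uv uw).
rewrite -r0 addnA r1; congr (_ + _)%N; by rewrite /nA cardfE.
Qed.

End SquareComplexHomology.

Theorem corollary1p3 (R : realType) (P : set 'rV[R]_3) :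
  convex_polyhedron P ->
  [/\ 0 <= antipodal_defect P,
      (nA P)%:Z - (nB P)%:Z <= (nV P)%:Z - 1 &
      antipodal_defect P = (betti (square_complex P) 2)%:Z].
Proof.
move=> hP.
have E : antipodal_defect P = (betti (square_complex P) 2)%:Z.
  have nBE : #|cells2 (square_complex P)| = nB P by rewrite /nB cardfE.
  (* The rank is at most the number of squares, so the truncated subtraction of [betti2E] is
     exact. *)
  have := rank_leq_row (boundary (square_complex P) 1); rewrite betti2E.
  have := square_complex_rank hP; rewrite /antipodal_defect.
  move: (\rank _) => r rE /= rB; rewrite -subzn // nBE; move: rE.
  move=> /(congr1 Posz); rewrite !PoszD => /(canRL (addrK _)) ->.
  by rewrite -[Posz 1]/(1 : int); ring.
have ge0 : 0 <= antipodal_defect P by rewrite E.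
split=> //; move: ge0; rewrite /antipodal_defect => ge0.
by rewrite -subr_ge0 opprB addrA addrAC.
Qed.
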